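(* Let $A$ be a homotopy unital dg algebra over $k$. Then there exists a (unital) dg algebra $B$ and a quasi-isomorphism of non-unital dg algebras $A\to B$. The dg algebra $B$ is determined uniquely up to a quasi-isomorphism of (unital) dg algebras.
   Context: $k$ is a fixed unital commutative ring. A non-unital dg algebra is an associative, not necessarily unital, differential $\mathbb{Z}$-graded $k$-algebra; a dg algebra without qualification is unital, with unital maps. A non-unital dg algebra $A$ is called homotopy unital if its homology $H(A)$ is a unital graded algebra. A quasi-isomorphism of non-unital dg algebras is a multiplicative chain map (not required to preserve units at the chain level) inducing an isomorphism on homology. By the paper's standing convention, dg algebras are first replaced by quasi-isomorphic cofibrant ones whenever necessary. ''Unique up to quasi-isomorphism'' means any two such $B$ are connected by a zig-zag of quasi-isomorphisms of unital dg algebras. *)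

(* Defs.v *)
From HB Require Import structures.
From Stdlib Require Export Relation_Operators.
From mathcomp Require Export all_boot all_algebra.
From mathcomp Require Import boolp.

Set Implicit Arguments.
Unset Strict Implicit.
Unset Printing Implicit Defensive.

Import GRing.Theory.
Local Open Scope ring_scope.
Local Open Scope quotient_scope.

(* A Z-graded k-module is its total module together with the projections
   [component n] onto its homogeneous summands: the two axioms say that the
   total module is the internal direct sum, over n : int, of the submodules
   {x | component n x = x}. *)
Record graded_module (k : comPzRingType) := GradedModule {
  total :> lmodType k;
  component : int -> {linear total -> total};
  component_comp : forall (m n : int) (x : total),
    component m (component n x) = if m == n then component n x else 0;
  component_sum : forall x : total, exists s : seq int,
    uniq s /\ x = \sum_(n <- s) component n x
}.

Arguments component {k M} n : rename.

Definition homogeneous (k : comPzRingType) (M : graded_module k) (n : int)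
  (x : M) : Prop := component n x = x.

(* Homological convention: the differential has degree -1. *)
Record nudga (k : comPzRingType) := NuDGA {
  nudga_graded :> graded_module k;
  mul : nudga_graded -> nudga_graded -> nudga_graded;
  diff : {linear nudga_graded -> nudga_graded};
  mul_linearl : forall y : nudga_graded, linear (mul^~ y);
  mul_linearr : forall x : nudga_graded, linear (mul x);
  mul_assoc : associative mul;
  mul_homogeneous : forall (m n : int) (x y : nudga_graded),
    homogeneous m x -> homogeneous n y -> homogeneous (m + n) (mul x y);
  diff_homogeneous : forall (n : int) (x : nudga_graded),
    homogeneous n x -> homogeneous (n - 1) (diff x);
  diff_diff : forall x : nudga_graded, diff (diff x) = 0;
  leibniz : forall (n : int) (x y : nudga_graded), homogeneous n x ->
    diff (mul x y) = mul (diff x) y + (-1) ^+ `|n|%N *: mul x (diff y)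
}.

Arguments mul {k A} x y : rename.
Arguments diff {k A} : rename.

(* The zero algebra is allowed: 1 = 0 is not excluded. *)
Record dga (k : comPzRingType) := DGA {
  dga_nudga :> nudga k;
  one : dga_nudga;
  one_homogeneous : homogeneous 0 one;
  mul_1x : left_id one mul;
  mul_x1 : right_id one mul
}.

Arguments one {k} B : rename.

Record nudga_hom (k : comPzRingType) (A B : nudga k) := NuDGAHom {
  hom_linear :> {linear A -> B};
  hom_mul : {morph hom_linear : x y / mul x y};
  hom_homogeneous : forall (n : int) (x : A),
    homogeneous n x -> homogeneous n (hom_linear x);
  hom_diff : forall x : A, hom_linear (diff x) = diff (hom_linear x)
}.

Record dga_hom (k : comPzRingType) (B C : dga k) := DGAHom {
  dga_hom_nudga :> nudga_hom B C;
  hom_one : dga_hom_nudga (one B) = one C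
}.

Section Homology.
Variables (k : comPzRingType) (A : nudga k).
Implicit Types x y z : A.

Definition is_cycle : {pred A} := [pred x | diff x == 0].

Fact is_cycle_zmod_closed : zmod_closed is_cycle.
Proof.
split=> [|x y]; first by rewrite inE linear0.
by rewrite !inE => /eqP dx /eqP dy; rewrite linearB dx dy subr0.
Qed.

HB.instance Definition _ :=
  GRing.isZmodClosed.Build A is_cycle is_cycle_zmod_closed.

Record cycles := Cycle { cycle_val :> A; _ : cycle_val \in is_cycle }.

HB.instance Definition _ := [isSub for cycle_val].
HB.instance Definition _ := [Choice of cycles by <:].
HB.instance Definition _ := [SubChoice_isSubZmodule of cycles by <:].

Lemma cycleP (c : cycles) : diff (c : A) = 0.
Proof. by apply/eqP; have := valP c; rewrite inE. Qed.

Definition is_boundary : {pred cycles} :=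
  [pred c : cycles | `[< exists x : A, diff x = (c : A) >]].

Fact is_boundary_zmod_closed : zmod_closed is_boundary.
Proof.
split=> [|c c']; rewrite !inE.
  by apply/asboolP; exists 0; rewrite linear0.
move=> /asboolP[x dx] /asboolP[x' dx']; apply/asboolP; exists (x - x').
by rewrite linearB dx dx'.
Qed.

HB.instance Definition _ :=
  GRing.isZmodClosed.Build cycles is_boundary is_boundary_zmod_closed.

Definition homology : Type := Quotient.quot is_boundary.

Definition homology_class (c : cycles) : homology :=
  \pi_(Quotient.quot is_boundary) c.

Definition homology_homogeneous (n : int) (u : homology) : Prop :=
  exists2 c : cycles, homogeneous n (c : A) & homology_class c = u.

Lemma homology_classP (c c' : cycles) :
  homology_class c = homology_class c' <->
  exists x : A, diff x = (c : A) - (c' : A).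
Proof.
have e : (c - c' \in is_boundary) = (homology_class c == homology_class c').
  exact: Quotient.idealrBE.
split=> [cc'|[x dx]].
  by move: e; rewrite cc' eqxx inE => /asboolP[x dx]; exists x.
by apply/eqP; rewrite -e inE; apply/asboolP; exists x.
Qed.

Definition homology_repr (u : homology) : cycles :=
  repr (u : Quotient.quot is_boundary).

Lemma homology_reprK (u : homology) : homology_class (homology_repr u) = u.
Proof. exact: reprK. Qed.

Lemma mul0x y : mul 0 y = 0.
Proof.
have := mul_linearl y 1 0 0; rewrite scaler0 addr0 scale1r => h.
by apply: (addrI (mul 0 y)); rewrite addr0 -h.
Qed.

Lemma mulx0 x : mul x 0 = 0.
Proof.
have := mul_linearr x 1 0 0; rewrite scaler0 addr0 scale1r => h.
by apply: (addrI (mul x 0)); rewrite addr0 -h.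
Qed.

Lemma mulDl x y z : mul (x + y) z = mul x z + mul y z.
Proof. by have := mul_linearl z 1 x y; rewrite !scale1r. Qed.

Lemma mulDr x y z : mul x (y + z) = mul x y + mul x z.
Proof. by have := mul_linearr x 1 y z; rewrite !scale1r. Qed.

Lemma component_homogeneous n x : homogeneous n (component n x).
Proof. by rewrite /homogeneous component_comp eqxx. Qed.

Lemma diff_component n x : diff (component n x) = component (n - 1) (diff x).
Proof.
have [s [us ex]] := component_sum x.
rewrite {2}ex !linear_sum /=.
have dh m : component (n - 1) (diff (component m x))
    = if m == n then diff (component n x) else 0.
  have hm := diff_homogeneous (component_homogeneous m x).
  rewrite -hm component_comp hm (inj_eq (addIr _)) eq_sym.
  by case: eqP => // ->.
under eq_bigr do rewrite dh.
have [ns|ns] := boolP (n \in s).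
  rewrite (bigD1_seq n) //= eqxx big1 ?addr0 // => m /negbTE -> //.
rewrite big1_seq => [|m /andP[_ ms]].
  rewrite ex linear_sum big1_seq ?linear0 // => m /andP[_ ms].
  by rewrite component_comp; case: eqP ms => // <-; rewrite (negbTE ns).
by case: eqP ms => // ->; rewrite (negbTE ns).
Qed.

Lemma diff_mul_cycler x y : diff y = 0 -> diff (mul x y) = mul (diff x) y.
Proof.
move=> dy; have [s [_ ->]] := component_sum x.
elim: s => [|n s IH]; first by rewrite big_nil mul0x !linear0 mul0x.
rewrite big_cons mulDl !linearD /= IH mulDl.
by rewrite (leibniz _ (component_homogeneous n x)) dy mulx0 scaler0 addr0.
Qed.

Lemma mul_cycle_diff x y : diff x = 0 -> exists z, diff z = mul x (diff y).
Proof.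
move=> dx; have [s [_ ->]] := component_sum x.
elim: s => [|n s [z IH]]; first by exists 0; rewrite big_nil mul0x linear0.
exists ((-1) ^+ `|n|%N *: mul (component n x) y + z).
rewrite big_cons mulDl linearD /= IH linearZ /=; congr (_ + _).
rewrite (leibniz _ (component_homogeneous n x)) diff_component dx linear0.
by rewrite mul0x add0r scalerA -exprMn mulrNN mulr1 expr1n scale1r.
Qed.

Fact mul_is_cycle (c c' : cycles) : mul (c : A) (c' : A) \in is_cycle.
Proof. by rewrite inE diff_mul_cycler ?cycleP // mul0x. Qed.

Definition cycle_mul (c c' : cycles) : cycles := Cycle (mul_is_cycle c c').

Definition homology_mul (u v : homology) : homology :=
  homology_class (cycle_mul (homology_repr u) (homology_repr v)).

Lemma homology_mulE (c c' : cycles) :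
  homology_mul (homology_class c) (homology_class c')
  = homology_class (cycle_mul c c').
Proof.
apply/homology_classP => /=.
have [x dx] := (homology_classP _ _).1 (homology_reprK (homology_class c)).
have [y dy] := (homology_classP _ _).1 (homology_reprK (homology_class c')).
move: dx dy; set a := homology_repr _; set b := homology_repr _ => dx dy.
have [z dz] := mul_cycle_diff y (cycleP c).
exists (mul x b + z); rewrite linearD /= diff_mul_cycler ?cycleP // dz dx dy.
have {2}-> : (a : A) = ((a : A) - (c : A)) + (c : A) by rewrite subrK.
rewrite [in RHS]mulDl -addrA; congr (_ + _).
have {2}-> : (b : A) = ((b : A) - (c' : A)) + (c' : A) by rewrite subrK.
by rewrite [in RHS]mulDr addrK.
Qed.

End Homology.

(* H(A) is a unital graded algebra; its unit necessarily has degree 0. *)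
Definition homotopy_unital (k : comPzRingType) (A : nudga k) : Prop :=
  exists u : homology A,
    [/\ homology_homogeneous 0 u,
        left_id u (@homology_mul k A)
      & right_id u (@homology_mul k A)].

Section HomologyMap.
Variables (k : comPzRingType) (A B : nudga k) (f : nudga_hom A B).

Fact hom_is_cycle (c : cycles A) : f (c : A) \in @is_cycle k B.
Proof. by rewrite inE -hom_diff cycleP linear0. Qed.

Definition cycle_map (c : cycles A) : cycles B := Cycle (hom_is_cycle c).

Definition homology_map (u : homology A) : homology B :=
  homology_class (cycle_map (homology_repr u)).

Lemma homology_mapE (c : cycles A) :
  homology_map (homology_class c) = homology_class (cycle_map c).
Proof.
apply/homology_classP => /=.
have [x dx] := (homology_classP _ _).1 (homology_reprK (homology_class c)).
by exists (f x); rewrite -hom_diff dx linearB.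
Qed.

Definition quasi_iso : Prop := bijective homology_map.

End HomologyMap.

(* Cofibrancy in the model category of non-unital dg algebras over k, whose
   weak equivalences are the quasi-isomorphisms and whose fibrations are the
   surjections: 0 -> Q lifts against every surjective quasi-isomorphism. *)
Definition cofibrant (k : comPzRingType) (Q : nudga k) : Prop :=
  forall (E F : nudga k) (p : nudga_hom E F) (g : nudga_hom Q F),
    (forall y : F, exists x : E, p x = y) -> quasi_iso p ->
    exists h : nudga_hom Q E, forall x : Q, p (h x) = g x.

Definition dga_quasi_isomorphic (k : comPzRingType) : dga k -> dga k -> Prop :=
  clos_refl_sym_trans (dga k)
    (fun B C => exists f : dga_hom B C, quasi_iso f).

(* Main.v *)
From HB Require Import structures.
Require Import Defs.
From mathcomp Require Import boolp functions.

(** The two ideas are a strictly unital model of the endomorphisms of a module,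
    and a derivation of all its homological properties from the lifting
    property of algebras.

    Existence. Regard Q as a right module over itself and let End(Q) be the dg
    algebra of its right linear endomorphisms of bounded degree; it is unital,
    and left multiplication Q -> End(Q) is a homomorphism of non-unital dg
    algebras. When Q is cofibrant and a cycle e represents the unit of H(Q), it
    is a quasi-isomorphism: a right linear cycle h : Q -> Q is homotopic to left
    multiplication by h(e), because both have homologous values at e, and the
    values on e Q decide the homotopy class since x |-> e x is a
    quasi-isomorphism of Q, hence invertible up to homotopy
    ([module_cycle], [module_cycle_inj], [left_mul_qis]).

    The homotopy theory of modules that this uses is one statement,
    [module_lift]: maps from Q into the cone of a quasi-isomorphism of modules
    are null-homotopic. It follows from cofibrancy of Q as an algebra: make the
    cone a square-zero ideal with zero left action, adjoin it to Q with a
    differential twisted by the given map; the projection onto Q is a surjective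
    quasi-isomorphism, and a section of it is a null-homotopy.

    Uniqueness. If f : Q -> B is a quasi-isomorphism, Q is cofibrant and B is
    unital, then Hom_Q(Q, B) is a B-End(Q)-bimodule which receives
    quasi-isomorphisms from both sides. The triangular matrices with entries in
    B, End(Q) and a shift of Hom_Q(Q, B), with differential twisted by f, form a
    unital dg algebra [glue f] which projects to B and to End(Q) by
    quasi-isomorphisms; so B is quasi-isomorphic to End(Q). Let R be a
    cofibrant replacement of A. Given Q -> A and Q -> B, a cofibrant replacement
    S of Q maps to R over A by lifting, and comparing B and End(R) with End(S)
    through S -> B and S -> R -> End(R) shows that B is quasi-isomorphic to
    End(R), which depends only on A.

    Cofibrant replacements. In the small object argument every cell kills a
    cycle z by a generator that is sent to a chosen a in A with d a = p z; as z
    itself involves earlier cells, the cells are the leaves of an inductive type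
    of terms. Two terms are identified when they agree in every graded algebra,
    so that the quotient is free; the differential and the map to A are defined
    by recursion on terms, the differential descending to the quotient because
    it is the second component of a homomorphism to a square-zero extension.
    Lifts against surjective quasi-isomorphisms are again constructed by
    recursion on terms ([replacement_cofibrant]), and the cells make the map to
    A a surjective quasi-isomorphism ([augmentation_qis]). *)

Set Implicit Arguments.
Unset Strict Implicit.
Unset Printing Implicit Defensive.

Import GRing.Theory.
Local Open Scope ring_scope.
Local Open Scope quotient_scope.

(** * Graded modules *)

Lemma big_finsupp_sub (V : nmodType) (s t : seq int) (g : int -> V) :
  uniq s -> uniq t -> {subset s <= t} -> (forall n, n \notin s -> g n = 0) ->
  \sum_(n <- t) g n = \sum_(n <- s) g n.
Proof.
move=> us ut st g0; rewrite (bigID [in s]) /= [X in _ + X]big1 ?addr0 //.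
rewrite -big_filter; apply: perm_big; apply: uniq_perm => //.
  exact: filter_uniq.
by move=> n; rewrite mem_filter; case: (boolP (n \in s)) => //= /st ->.
Qed.

Lemma big_finsupp (V : nmodType) (s t : seq int) (g : int -> V) :
  uniq s -> uniq t -> (forall n, n \notin s -> g n = 0) ->
  (forall n, n \notin t -> g n = 0) ->
  \sum_(n <- t) g n = \sum_(n <- s) g n.
Proof.
move=> us ut gs gt.
rewrite -(@big_finsupp_sub _ s (undup (s ++ t))) ?undup_uniq //; last first.
  by move=> n ns; rewrite mem_undup mem_cat ns.
rewrite -(@big_finsupp_sub _ t (undup (s ++ t))) ?undup_uniq //.
by move=> n ns; rewrite mem_undup mem_cat ns orbT.
Qed.

Section Degsign.
Variable k : comPzRingType.

Definition degsign (n : int) : k := (-1) ^+ `|n|%N.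

Lemma degsign_sqr n : degsign n * degsign n = 1.
Proof. by rewrite /degsign -exprMn mulrNN mulr1 expr1n. Qed.

Lemma degsign_odd n : degsign n = (-1) ^+ odd `|n|%N.
Proof. by rewrite signr_odd. Qed.

Lemma odd_absz_addn (m n : int) : odd `|(m + n)%R|%N = odd `|m|%N (+) odd `|n|%N.
Proof.
have sub a b : odd `|(a%:Z - b%:Z)%R|%N = odd a (+) odd b.
  have [ba|/ltnW ab] := leqP b a; first by rewrite distnEl ?oddB.
  by rewrite distnC distnEl ?oddB // addbC.
case: m n => [a|a] [b|b]; rewrite ?NegzE.
- by rewrite -PoszD !absz_nat oddD.
- by rewrite sub abszN.
- by rewrite addrC sub addbC abszN.
- by rewrite -opprD !abszN -PoszD !absz_nat oddD.
Qed.

Lemma degsignD m n : degsign (m + n) = degsign m * degsign n.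
Proof. by rewrite !degsign_odd odd_absz_addn signr_addb. Qed.

Lemma degsignN n : degsign (- n) = degsign n.
Proof. by rewrite /degsign abszN. Qed.

Lemma degsign0 : degsign 0 = 1.
Proof. by []. Qed.

Lemma degsign1 : degsign 1 = -1.
Proof. by []. Qed.

Lemma degsignD1 n : degsign (n + 1) = - degsign n.
Proof. by rewrite degsignD degsign1 mulrN1. Qed.

End Degsign.

Section Graded.
Variables (k : comPzRingType) (M : graded_module k).
Implicit Types x y : M.

Definition gsupp x : seq int := sval (cid (component_sum x)).

Lemma gsupp_uniq x : uniq (gsupp x).
Proof. by rewrite /gsupp; case: cid => s []. Qed.

Lemma sum_component x : \sum_(n <- gsupp x) component n x = x.
Proof. by rewrite /gsupp; case: cid => s []. Qed.

Lemma hom_component n x : homogeneous n (component n x).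
Proof. by rewrite /homogeneous component_comp eqxx. Qed.

Lemma component_out n x : n \notin gsupp x -> component n x = 0.
Proof.
move=> ns; rewrite -[x in component n x]sum_component linear_sum big1_seq //= => m.
by rewrite component_comp; case: eqP ns => // -> /negbTE ->.
Qed.

Lemma component_hom m n x : homogeneous n x ->
  component m x = if m == n then x else 0.
Proof. by move=> xn; rewrite -{1}xn component_comp xn. Qed.

Lemma sum_component_on s x : uniq s -> (forall n, n \notin s -> component n x = 0) ->
  \sum_(n <- s) component n x = x.
Proof.
move=> us sx; rewrite -[RHS]sum_component; apply: big_finsupp => //.
- exact: gsupp_uniq.
- by move=> n; apply: component_out.
Qed.

Lemma graded_ind (P : M -> Prop) : P 0 -> (forall x y, P x -> P y -> P (x + y)) ->
  (forall n x, homogeneous n x -> P x) -> forall x, P x.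
Proof.
move=> P0 PD Ph x; rewrite -[x]sum_component.
by elim/big_ind: _ => // n _; apply/Ph/hom_component.
Qed.

Lemma hom0 n : homogeneous n (0 : M).
Proof. by rewrite /homogeneous linear0. Qed.

Lemma homD n x y : homogeneous n x -> homogeneous n y -> homogeneous n (x + y).
Proof. by rewrite /homogeneous linearD /= => -> ->. Qed.

Lemma homZ n c x : homogeneous n x -> homogeneous n (c *: x).
Proof. by rewrite /homogeneous linearZ /= => ->. Qed.

Lemma homN n x : homogeneous n x -> homogeneous n (- x).
Proof. by rewrite /homogeneous linearN /= => ->. Qed.

Lemma homB n x y : homogeneous n x -> homogeneous n y -> homogeneous n (x - y).
Proof. by move=> ? /homN; apply: homD. Qed.

Section Ext.
Variable W : lmodType k.

Definition gext (F : int -> M -> W) x : W :=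
  \sum_(n <- gsupp x) F n (component n x).

Variable F : int -> M -> W.
Hypothesis F_linear : forall n, linear (F n).

Let F0 n : F n 0 = 0.
Proof.
have := F_linear n 1 0 0; rewrite scaler0 addr0 scale1r => h.
by apply: (addrI (F n 0)); rewrite addr0 -h.
Qed.

Lemma gext_on s x : uniq s -> (forall n, n \notin s -> component n x = 0) ->
  gext F x = \sum_(n <- s) F n (component n x).
Proof.
move=> us sx; apply: big_finsupp => // [|n ns|n ns].
- exact: gsupp_uniq.
- by rewrite sx.
- by rewrite component_out.
Qed.

Lemma gext_hom n x : homogeneous n x -> gext F x = F n x.
Proof.
move=> xn; rewrite (@gext_on [:: n]) // ?big_seq1 ?xn // => m.
by rewrite inE (component_hom m xn) => /negbTE ->.
Qed.

Lemma gext_linear : linear (gext F).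
Proof.
move=> c x y; pose s := undup (gsupp x ++ gsupp y).
have sx n : n \notin s -> component n x = 0.
  by rewrite mem_undup mem_cat negb_or => /andP[/component_out].
have sy n : n \notin s -> component n y = 0.
  by rewrite mem_undup mem_cat negb_or => /andP[_ /component_out].
rewrite !(@gext_on s) ?undup_uniq //; last first.
  by move=> n ns; rewrite linearP /= sx ?sy // scaler0 addr0.
rewrite scaler_sumr -big_split; apply: eq_bigr => n _ /=.
by rewrite linearP F_linear.
Qed.

End Ext.

(** The grading involution. It turns the signs that depend on a degree into a
    linear map, so that identities such as the Leibniz rule can be stated for
    inhomogeneous elements. *)
Definition gsign x : M := gext (fun n y => degsign k n *: y) x.

Fact gsign_is_linear : linear gsign.
Proof.
apply: gext_linear => n c x y.
by rewrite scalerDr !scalerA [c * _]mulrC.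
Qed.
HB.instance Definition _ := GRing.isLinear.Build k M M _ gsign gsign_is_linear.

Lemma gsign_hom n x : homogeneous n x -> gsign x = degsign k n *: x.
Proof.
apply: gext_hom => m c u v.
by rewrite scalerDr !scalerA [c * _]mulrC.
Qed.

Lemma hom_gsign n x : homogeneous n x -> homogeneous n (gsign x).
Proof. by move=> xn; rewrite (gsign_hom xn); apply: homZ. Qed.

Lemma gsignK x : gsign (gsign x) = x.
Proof.
elim/graded_ind: x => [|x y|n x xn]; rewrite ?linear0 //.
  by rewrite !linearD /= => -> ->.
by rewrite (gsign_hom xn) linearZ /= (gsign_hom xn) scalerA degsign_sqr scale1r.
Qed.

End Graded.

(** Not stated for a map with a linear structure: it is applied to one-sided
    multiplications. *)
Lemma component_homs (k : comPzRingType) (M N : graded_module k)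
    (F : M -> N) (a : int) : linear F ->
  (forall n x, homogeneous n x -> homogeneous (n + a) (F x)) ->
  forall n x, component (n + a) (F x) = F (component n x).
Proof.
move=> Fl Fh n.
pose G := HB.pack_for {linear M -> N} F (GRing.isLinear.Build _ _ _ _ F Fl).
rewrite -[F]/(G : M -> N); elim/graded_ind => [|x y|m x xm].
- by rewrite !linear0.
- by rewrite !linearD /= => -> ->.
rewrite (component_hom n xm) (component_hom _ (Fh _ _ xm)) (inj_eq (addIr _)).
by case: eqP; rewrite ?linear0.
Qed.

Lemma gsign_homs (k : comPzRingType) (M N : graded_module k)
    (F : {linear M -> N}) (a : int) :
  (forall n x, homogeneous n x -> homogeneous (n + a) (F x)) ->
  forall x, gsign (F x) = degsign k a *: F (gsign x).
Proof.
move=> Fh; elim/graded_ind => [|x y|m x xm].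
- by rewrite !linear0.
- by rewrite !linearD /= => -> ->.
rewrite (gsign_hom (Fh _ _ xm)) (gsign_hom xm) linearZ /= scalerA degsignD.
by rewrite mulrC.
Qed.

(** * Non-unital dg algebras and quasi-isomorphisms *)

Section NudgaTheory.
Variables (k : comPzRingType) (A : nudga k).
Implicit Types x y z : A.

Lemma mulZl c x y : mul (c *: x) y = c *: mul x y.
Proof. by have := mul_linearl y c x 0; rewrite !addr0 mul0x addr0. Qed.

Lemma mulZr c x y : mul x (c *: y) = c *: mul x y.
Proof. by have := mul_linearr x c y 0; rewrite !addr0 mulx0 addr0. Qed.

Lemma mulNl x y : mul (- x) y = - mul x y.
Proof. by rewrite -scaleN1r mulZl scaleN1r. Qed.

Lemma mulNr x y : mul x (- y) = - mul x y.
Proof. by rewrite -scaleN1r mulZr scaleN1r. Qed.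

Lemma mulBl x y z : mul (x - y) z = mul x z - mul y z.
Proof. by rewrite mulDl mulNl. Qed.

Lemma mulBr x y z : mul x (y - z) = mul x y - mul x z.
Proof. by rewrite mulDr mulNr. Qed.

Lemma gsign_mul x y : gsign (mul x y) = mul (gsign x) (gsign y).
Proof.
elim/graded_ind: x => [|x x'|m x xm].
- by rewrite mul0x !linear0 mul0x.
- by rewrite mulDl !linearD mulDl /= => -> ->.
elim/graded_ind: y => [|y y'|n y yn].
- by rewrite mulx0 !linear0 mulx0.
- by rewrite mulDr !linearD mulDr /= => -> ->.
rewrite (gsign_hom (mul_homogeneous xm yn)) (gsign_hom xm) (gsign_hom yn).
by rewrite mulZl mulZr scalerA degsignD.
Qed.

Lemma gsign_diff x : gsign (diff x) = - diff (gsign x).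
Proof.
rewrite (@gsign_homs _ _ _ (@diff k A) (-1)); last exact: diff_homogeneous.
by rewrite degsignN degsign1 scaleN1r.
Qed.

Lemma leibniz_gsign x y : diff (mul x y) = mul (diff x) y + mul (gsign x) (diff y).
Proof.
elim/graded_ind: x => [|x x' IH IH'|m x xm].
- by rewrite !(mul0x, linear0) addr0.
- by rewrite !(linearD, mulDl) /= IH IH' addrACA.
by rewrite (leibniz y xm) (gsign_hom xm) mulZl.
Qed.

Lemma component_diff n x : component n (diff x) = diff (component (n + 1) x).
Proof. by rewrite diff_component addrK. Qed.

Lemma boundary_sum x : (forall n, exists y, diff y = component n x) ->
  exists y, diff y = x.
Proof.
move=> bx; rewrite -[x]sum_component.
elim/big_ind: _ => [|_ _ [y <-] [y' <-]|n _]; last exact: bx.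
  by exists 0; rewrite linear0.
by exists (y + y'); rewrite linearD.
Qed.

End NudgaTheory.

(** Bijectivity on homology classes, spelled out on cycles. Unlike [quasi_iso]
    it makes sense for chain maps that are not multiplicative, such as the
    module maps below. *)
Definition qis (k : comPzRingType) (A B : nudga k) (g : A -> B) : Prop :=
  (forall x, diff x = 0 -> (exists y, diff y = g x) -> exists z, diff z = x) /\
  (forall y, diff y = 0 -> exists x w, diff x = 0 /\ y = g x + diff w).

Section Qis.
Variables (k : comPzRingType).

Lemma cycle_exists (A : nudga k) (x : A) : diff x = 0 -> exists c : cycles A,
  c = x :> A.
Proof. by move=> /eqP dx; exists (@Cycle _ _ x dx). Qed.

Lemma quasi_isoP (A B : nudga k) (f : nudga_hom A B) : quasi_iso f <-> qis f.
Proof.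
split=> [[g fK gK]|[inj sur]].
  split=> [x dx [y dy]|y dy].
    have [c cx] := cycle_exists dx.
    have : homology_class c = homology_class 0.
      apply: (can_inj fK); rewrite !homology_mapE; apply/homology_classP => /=.
      by exists y; rewrite dy cx linear0 subr0.
    by case/homology_classP => z dz; exists z; rewrite dz cx subr0.
  have [c cy] := cycle_exists dy; pose c' := homology_repr (g (homology_class c)).
  have : homology_class c = homology_class (cycle_map f c').
    by rewrite -homology_mapE homology_reprK gK.
  case/homology_classP => w dw; exists (c' : A), w; split; first exact: cycleP.
  by rewrite dw /= cy addrC subrK.
have finj : injective (homology_map f).
  move=> u v; rewrite -[u]homology_reprK -[v]homology_reprK !homology_mapE.
  move: (homology_repr u) (homology_repr v) => c c'.
  case/homology_classP => y /= dy; apply/homology_classP; apply: inj.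
    by rewrite linearB /= !cycleP subrr.
  by exists y; rewrite dy linearB.
have fsur v : exists u, homology_map f u = v.
  rewrite -[v]homology_reprK; move: (homology_repr v) => c.
  have [x [w [dx cx]]] := sur _ (cycleP c).
  have [c' c'x] := cycle_exists dx; exists (homology_class c').
  rewrite homology_mapE; apply/homology_classP; exists (- w) => /=.
  by rewrite linearN /= cx c'x opprD addrA subrr add0r.
exists (fun v => sval (cid (fsur v))) => [u|v]; last by case: cid.
by apply: finj; case: cid.
Qed.


Lemma component_hom_map (A B : nudga k) (f : nudga_hom A B) n x :
  component n (f x) = f (component n x).
Proof.
have := @component_homs _ A B f 0 (@linearP _ _ _ _ f) _ n x.
by rewrite addr0; apply=> m y; rewrite addr0; apply: hom_homogeneous.
Qed.

Lemma gsign_hom_map (A B : nudga k) (f : nudga_hom A B) x :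
  gsign (f x) = f (gsign x).
Proof.
rewrite (@gsign_homs _ _ _ f 0) ?scale1r // => m y.
by rewrite addr0; apply: hom_homogeneous.
Qed.

Definition id_hom (A : nudga k) : nudga_hom A A :=
  @NuDGAHom k A A idfun (fun _ _ => erefl) (fun _ _ xn => xn) (fun _ => erefl).

Definition comp_hom (A B C : nudga k) (g : nudga_hom B C) (f : nudga_hom A B) :
  nudga_hom A C.
Proof.
apply: (@NuDGAHom k A C (g \o f)) => [x y|n x xn|x] /=.
- by rewrite !hom_mul.
- by do 2!apply: hom_homogeneous.
- by rewrite !hom_diff.
Defined.

Lemma qis_comp (A B C : nudga k) (g : nudga_hom B C) (f : nudga_hom A B) :
  qis g -> qis f -> qis (comp_hom g f).
Proof.
move=> [gi gs] [fi fs]; split=> [x dx [y dy]|y dy].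
  by apply: fi => //; apply: gi; [rewrite -hom_diff dx linear0 | exists y].
have [z [w [dz ->]]] := gs _ dy; have [x [v [dx ->]]] := fs _ dz.
by exists x, (g v + w); split=> //=; rewrite !linearD /= hom_diff addrA.
Qed.

Lemma qis_cancel (A B C : nudga k) (g : nudga_hom B C) (f : nudga_hom A B)
    (h : nudga_hom A C) :
  (forall x, g (f x) = h x) -> qis g -> qis h -> qis f.
Proof.
move=> gf [gi gs] [hi hs]; split=> [x dx [y dy]|y dy].
  by apply: hi => //; exists (g y); rewrite -hom_diff dy gf.
have [|x [w [dx ex]]] := hs (g y); first by rewrite -hom_diff dy linear0.
have [||z dz] := gi (y - f x).
- by rewrite linearB /= dy -hom_diff dx linear0 subr0.
- by exists w; rewrite linearB /= gf ex addrC addKr.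
by exists x, z; split=> //; rewrite dz addrC subrK.
Qed.

(** Since differentials and homomorphisms respect the grading, it is enough to
    look at homogeneous cycles. *)
Lemma qis_homogeneous (A B : nudga k) (f : nudga_hom A B) :
  (forall n x, homogeneous n x -> diff x = 0 ->
    (exists2 y, homogeneous (n + 1) y & diff y = f x) -> exists z, diff z = x) ->
  (forall n y, homogeneous n y -> diff y = 0 ->
    exists x w, diff x = 0 /\ y = f x + diff w) -> qis f.
Proof.
move=> inj sur; split=> [x dx [y dy]|y dy].
  apply: boundary_sum => n; apply: (inj n); first exact: hom_component.
    by rewrite diff_component dx linear0.
  exists (component (n + 1) y); first exact: hom_component.
  by rewrite -component_diff dy component_hom_map.
rewrite -[y]sum_component.
elim/big_ind: _ => [|_ _ [x [w [dx ->]]] [x' [w' [dx' ->]]]|n _].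
- by exists 0, 0; rewrite !linear0 addr0.
- by exists (x + x'), (w + w'); rewrite !linearD /= dx dx' addr0 addrACA.
by apply: (sur n); [apply: hom_component | rewrite diff_component dy linear0].
Qed.

(** The long exact homology sequence of an epimorphism, in the case of an
    acyclic kernel. *)
Lemma qis_onto (A B : nudga k) (f : nudga_hom A B) :
  (forall y, exists x, f x = y) ->
  (forall n x, homogeneous n x -> diff x = 0 -> f x = 0 ->
    exists2 z, f z = 0 & diff z = x) -> qis f.
Proof.
move=> sur acy; have ker x : diff x = 0 -> f x = 0 ->
    exists2 z, f z = 0 & diff z = x.
  move=> dx fx; rewrite -[x]sum_component.
  elim/big_ind: _ => [|_ _ [z fz <-] [z' fz' <-]|n _].
  - by exists 0; rewrite !linear0.
  - by exists (z + z'); rewrite !linearD //= fz fz' addr0.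
  apply: (acy n); first exact: hom_component.
    by rewrite diff_component dx linear0.
  by rewrite -component_hom_map fx linear0.
split=> [x dx [y dy]|y dy].
  have [x' fx'] := sur y; have [||z fz dz] := ker (x - diff x').
  - by rewrite linearB /= dx diff_diff subr0.
  - by rewrite linearB /= hom_diff fx' dy subrr.
  by exists (z + x'); rewrite linearD /= dz subrK.
have [x fx] := sur y; have [||z fz dz] := ker (diff x); rewrite ?diff_diff //.
  by rewrite hom_diff fx dy.
exists (x - z), 0; rewrite !linearB /= dz subrr fz subr0 linear0 addr0 fx.
by split.
Qed.

(** A surjective quasi-isomorphism lifts a single cell: the boundary e of the
    lift can be prescribed, provided it lies over the boundary of y. *)
Lemma onto_qis_lift (E F : nudga k) (q : nudga_hom E F) :
  (forall y, exists x, q x = y) -> qis q ->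
  forall n (e : E) (y : F), homogeneous (n - 1) e -> homogeneous n y ->
  diff e = 0 -> diff y = q e ->
  exists x, [/\ homogeneous n x, diff x = e & q x = y].
Proof.
move=> sur [qi qs] n e y en yn de dy.
have [x1 dx1] := qi e de (ex_intro _ y dy).
have [|c [w [dc ec]]] := qs (q x1 - y).
  by rewrite linearB /= -hom_diff dx1 dy subrr.
have [v qv] := sur w; exists (component n (x1 - c - diff v)); split.
- exact: hom_component.
- by rewrite diff_component !linearB /= dx1 dc diff_diff !linear0 ?subr0 ?addr0 en.
have qy : q (x1 - c - diff v) = y.
  by rewrite !linearB /= hom_diff qv -addrA -opprD -ec opprB addrC subrK.
by rewrite -component_hom_map qy yn.
Qed.

Definition homology_unit (A : nudga k) (e : A) : Prop :=
  [/\ homogeneous 0 e, diff e = 0 & forall x, diff x = 0 ->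
    (exists y, diff y = mul e x - x) /\ (exists y, diff y = mul x e - x)].

Lemma homotopy_unitalP (A : nudga k) :
  homotopy_unital A -> exists e : A, homology_unit e.
Proof.
case=> u [[c c0 cu] ul ur]; exists (c : A); split=> // [|x dx]; first exact: cycleP.
have [x' xx'] := cycle_exists dx; split.
  have := ul (homology_class x'); rewrite -cu homology_mulE.
  by case/homology_classP=> y /= dy; exists y; rewrite dy -xx'.
have := ur (homology_class x'); rewrite -cu homology_mulE.
by case/homology_classP=> y /= dy; exists y; rewrite dy -xx'.
Qed.

(** The component of degree 0 of any cycle over e will do, because f identifies
    the homology algebras. *)
Lemma homology_unit_lift (A B : nudga k) (f : nudga_hom A B) (e : B) :
  qis f -> homology_unit e -> exists e' : A, homology_unit e'.
Proof.
move=> [inj sur] [e0 de eu]; have [c [w [dc ec]]] := sur _ de.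
pose e' := component 0 c; have de' : diff e' = 0.
  by rewrite diff_component dc linear0.
have fe' : f e' = e - diff (component 1 w).
  have -> : f e' = component 0 (f c) by rewrite component_hom_map.
  by rewrite -(component_diff 0) -{1}e0 ec linearD /= addrK.
exists e'; split=> // [|x dx]; first exact: hom_component.
have dfx : diff (f x) = 0 by rewrite -hom_diff dx linear0.
have [[y dy] [y' dy']] := eu _ dfx; split; apply: inj.
- by rewrite linearB /= leibniz_gsign de' dx mul0x mulx0 addr0 subrr.
- exists (y - mul (component 1 w) (f x)); rewrite !linearB /= hom_mul fe' mulBl dy.
  by rewrite leibniz_gsign dfx mulx0 addr0 addrAC.
- by rewrite linearB /= leibniz_gsign de' dx mul0x mulx0 addr0 subrr.
- have [z dz] := mul_cycle_diff (component 1 w) dfx.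
  by exists (y' - z); rewrite !linearB /= hom_mul fe' mulBr dy' dz addrAC.
Qed.

End Qis.

(** * Sums and shifts of graded modules *)

Section GProd.
Variables (k : comPzRingType) (M N : graded_module k).

Definition gprod_component n (u : (M * N)%type) : (M * N)%type :=
  (component n u.1, component n u.2).

Fact gprod_component_linear n : linear (gprod_component n).
Proof. by move=> c u v; rewrite /gprod_component /= !linearP. Qed.

HB.instance Definition _ n := GRing.isLinear.Build k (M * N)%type (M * N)%type _
  (gprod_component n) (gprod_component_linear n).

Definition gprod : graded_module k.
Proof.
apply: (@GradedModule k (M * N)%type (fun n => gprod_component n : {linear _ -> _})).
  move=> m n u; rewrite /= /gprod_component /= !component_comp.
  by case: eqP.
move=> u; exists (undup (gsupp u.1 ++ gsupp u.2)); split; first exact: undup_uniq.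
have sumE (s : seq int) : \sum_(n <- s) gprod_component n u =
    (\sum_(n <- s) component n u.1, \sum_(n <- s) component n u.2).
  by elim: s => [|n s IH]; rewrite ?big_nil ?big_cons ?IH.
rewrite /= sumE !sum_component_on ?undup_uniq -?surjective_pairing // => n.
  by rewrite mem_undup mem_cat negb_or => /andP[_ /component_out].
by rewrite mem_undup mem_cat negb_or => /andP[/component_out].
Defined.

Lemma gprod_hom n (u : gprod) :
  homogeneous n u <-> homogeneous n u.1 /\ homogeneous n u.2.
Proof.
rewrite /homogeneous /= /gprod_component.
by case: u => u v; split=> [[/= -> ->]|[/= -> ->]].
Qed.

End GProd.

Section GShift.
Variables (k : comPzRingType) (M : graded_module k) (a : int).

Definition gshift : graded_module k.
Proof.
apply: (@GradedModule k M (fun n => @component k M (n + a))).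
  by move=> m n x; rewrite component_comp (inj_eq (addIr a)).
move=> x; exists [seq n - a | n <- gsupp x]; split.
  by rewrite map_inj_uniq ?gsupp_uniq //; apply: addIr.
rewrite big_map -[LHS]sum_component; apply: eq_bigr => n _.
by rewrite subrK.
Defined.

End GShift.

(** * Cofibrant replacement *)

Section Terms.
Variables (k : comPzRingType) (A : nudga k).

(** [TGen z a n] is the cell of degree n that is to have boundary z and image a.
    The index z is a term and not an element of the quotient, which makes the
    type inductive at the cost of harmless repeated cells. All z, a and n are
    admitted; those that do not fit together give cells with boundary and image
    zero, see [bd] below. *)
Inductive term : Type :=
| TZero
| TAdd (s t : term)
| TScale (c : k) (t : term)
| TMul (s t : term)
| TComp (n : int) (t : term)
| TGen (z : term) (a : A) (n : int).

HB.instance Definition _ := gen_eqMixin term.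
HB.instance Definition _ := gen_choiceMixin term.

Section Eval.
Variables (X : nudga k) (phi : term -> A -> int -> X).

Fixpoint eval t : X :=
  match t with
  | TZero => 0
  | TAdd s t => eval s + eval t
  | TScale c t => c *: eval t
  | TMul s t => mul (eval s) (eval t)
  | TComp n t => component n (eval t)
  | TGen z a n => phi z a n
  end.

Definition graded_assignment := forall z a n, homogeneous n (phi z a n).

End Eval.

(** Agreement under all homogeneous assignments, the differential of X being
    disregarded: the quotient is the free graded algebra on the cells. The
    algebra laws hold in it since they hold in every X. *)
Definition term_eqv (s t : term) : bool :=
  `[< forall (X : nudga k) (phi : term -> A -> int -> X),
      graded_assignment phi -> eval phi s = eval phi t >].

Fact term_eqv_refl : reflexive term_eqv.
Proof. by move=> t; apply/asboolP. Qed.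

Fact term_eqv_sym : symmetric term_eqv.
Proof.
by move=> s t; apply/asboolP/asboolP => st X phi hphi; rewrite st.
Qed.

Fact term_eqv_trans : transitive term_eqv.
Proof.
move=> t s u /asboolP st /asboolP tu; apply/asboolP => X phi hphi.
by rewrite st ?tu.
Qed.

Canonical term_equiv := EquivRel term_eqv term_eqv_refl term_eqv_sym term_eqv_trans.

Definition free_type := {eq_quot term_eqv}.

HB.instance Definition _ := Choice.on free_type.

Definition cls (t : term) : free_type := \pi_{eq_quot term_eqv} t.
Definition rep (v : free_type) : term := repr (v : {eq_quot term_eqv}).

Lemma repK v : cls (rep v) = v.
Proof. exact: reprK. Qed.

Definition feval (X : nudga k) (phi : term -> A -> int -> X) (v : free_type) : X :=
  eval phi (rep v).

Section FreeEval.
Variables (X : nudga k) (phi : term -> A -> int -> X).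
Hypothesis hphi : graded_assignment phi.

Lemma feval_cls t : feval phi (cls t) = eval phi t.
Proof.
have /eqP := repK (cls t); rewrite /cls eqmodE => /asboolP.
by apply.
Qed.

End FreeEval.

Lemma free_ext (v w : free_type) :
  (forall (X : nudga k) (phi : term -> A -> int -> X),
     graded_assignment phi -> feval phi v = feval phi w) -> v = w.
Proof.
move=> vw; rewrite -[v]repK -[w]repK; apply/eqP; rewrite eqmodE.
by apply/asboolP => X phi hphi; apply: vw.
Qed.

Definition free_zero : free_type := cls TZero.
Definition free_add (v w : free_type) : free_type := cls (TAdd (rep v) (rep w)).
Definition free_scale c (v : free_type) : free_type := cls (TScale c (rep v)).
Definition free_opp := free_scale (-1).
Definition free_mul (v w : free_type) : free_type := cls (TMul (rep v) (rep w)).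
Definition free_component n (v : free_type) : free_type := cls (TComp n (rep v)).

Section FreeEvalOps.
Variables (X : nudga k) (phi : term -> A -> int -> X).
Hypothesis hphi : graded_assignment phi.

Let feval0 : feval phi free_zero = 0.
Proof. exact: feval_cls. Qed.

Let fevalD v w : feval phi (free_add v w) = feval phi v + feval phi w.
Proof. exact: feval_cls. Qed.

Let fevalZ c v : feval phi (free_scale c v) = c *: feval phi v.
Proof. exact: feval_cls. Qed.

Lemma feval_mul v w : feval phi (free_mul v w) = mul (feval phi v) (feval phi w).
Proof. exact: feval_cls. Qed.

Lemma feval_component n v :
  feval phi (free_component n v) = component n (feval phi v).
Proof. exact: feval_cls. Qed.

Definition fevalE := (feval0, fevalD, fevalZ, feval_mul, feval_component).

End FreeEvalOps.

Fact free_addA : associative free_add.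
Proof. by move=> u v w; apply: free_ext => X phi hphi; rewrite !fevalE // addrA. Qed.
Fact free_addC : commutative free_add.
Proof. by move=> u v; apply: free_ext => X phi hphi; rewrite !fevalE // addrC. Qed.
Fact free_add0 : left_id free_zero free_add.
Proof. by move=> u; apply: free_ext => X phi hphi; rewrite !fevalE // add0r. Qed.
Fact free_addN : left_inverse free_zero free_opp free_add.
Proof.
by move=> u; apply: free_ext => X phi hphi; rewrite !fevalE // scaleN1r addNr.
Qed.
HB.instance Definition _ :=
  GRing.isZmodule.Build free_type free_addA free_addC free_add0 free_addN.

Fact free_scaleA a b v : free_scale a (free_scale b v) = free_scale (a * b) v.
Proof. by apply: free_ext => X phi hphi; rewrite !fevalE // scalerA. Qed.
Fact free_scale1 : left_id 1 free_scale.
Proof. by move=> v; apply: free_ext => X phi hphi; rewrite !fevalE // scale1r. Qed.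
Fact free_scaleDr : right_distributive free_scale +%R.
Proof.
by move=> c v w; apply: free_ext => X phi hphi; rewrite !fevalE // scalerDr.
Qed.
Fact free_scaleDl v : {morph free_scale^~ v : a b / a + b}.
Proof.
by move=> a b; apply: free_ext => X phi hphi; rewrite !fevalE // scalerDl.
Qed.
HB.instance Definition _ := GRing.Zmodule_isLmodule.Build k free_type
  free_scaleA free_scale1 free_scaleDr free_scaleDl.

Lemma feval_linear (X : nudga k) (phi : term -> A -> int -> X) :
  graded_assignment phi -> linear (feval phi).
Proof. by move=> hphi c v w; rewrite !fevalE. Qed.

Fact free_component_linear n : linear (free_component n).
Proof.
move=> c v w; apply: free_ext => X phi hphi.
by rewrite !(fevalE, feval_linear) // linearP.
Qed.
HB.instance Definition _ n := GRing.isLinear.Build k free_type free_type _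
  (free_component n) (free_component_linear n).

(** A finite set of degrees that is valid for all X at once is what makes the
    components of a class sum up to that class. *)
Lemma eval_support t : exists2 s, uniq s &
  forall (X : nudga k) (phi : term -> A -> int -> X), graded_assignment phi ->
  forall n, n \notin s -> component n (eval phi t) = 0.
Proof.
suff [s h] : exists s : seq int, forall (X : nudga k)
    (phi : term -> A -> int -> X), graded_assignment phi ->
    forall n, n \notin s -> component n (eval phi t) = 0.
  exists (undup s) => [|X phi hphi n]; first exact: undup_uniq.
  by rewrite mem_undup; apply: h.
elim: t => [|s [S hS] t [T hT]|c t [T hT]|s [S hS] t [T hT]|m t [T hT]|z _ a n] /=.
- by exists [::] => X phi _ n _; rewrite linear0.
- exists (S ++ T) => X phi hphi n; rewrite mem_cat negb_or => /andP[nS nT].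
  by rewrite linearD /= hS ?hT ?addr0.
- by exists T => X phi hphi n nT; rewrite linearZ /= hT ?scaler0.
- exists [seq i + j | i <- S, j <- T] => X phi hphi n nST.
  rewrite -(@sum_component_on _ _ (undup S) (eval phi s)) ?undup_uniq //; last first.
    by move=> i; rewrite mem_undup; apply: hS.
  rewrite big_seq; apply: (big_rec (fun u => component n (mul u _) = 0)) => [|i u].
    by rewrite mul0x linear0.
  rewrite mem_undup => iS IH; rewrite mulDl linearD /= {}IH addr0.
  rewrite -(@sum_component_on _ _ (undup T) (eval phi t)) ?undup_uniq //; last first.
    by move=> j; rewrite mem_undup; apply: hT.
  rewrite big_seq; apply: (big_rec (fun w => component n (mul _ w) = 0)) => [|j w].
    by rewrite mulx0 linear0.
  rewrite mem_undup => jT IH; rewrite mulDr linearD /= {}IH addr0.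
  rewrite (component_hom n (mul_homogeneous (hom_component i _) (hom_component j _))).
  by case: eqP => // nij; case/negP: nST; rewrite nij; apply: allpairs_f.
- by exists T => X phi hphi n nT; rewrite component_comp; case: eqP => // <-; apply: hT.
exists [:: n] => X phi hphi m; rewrite inE => /negbTE mn.
by rewrite (component_hom m (hphi z a n)) mn.
Qed.

Definition free_graded : graded_module k.
Proof.
apply: (@GradedModule k free_type (fun n => free_component n : {linear _ -> _})).
  move=> m n v; apply: free_ext => X phi hphi.
  by rewrite /= !fevalE // component_comp; case: eqP; rewrite !fevalE.
move=> v; have [s us hs] := eval_support (rep v); exists s; split=> //.
apply: free_ext => X phi hphi.
pose L := HB.pack_for {linear free_type -> X} (feval phi)
  (GRing.isLinear.Build _ _ _ _ (feval phi) (feval_linear hphi)).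
rewrite -[feval phi]/(L : free_type -> X) linear_sum -[LHS](sum_component_on us).
  by apply: eq_bigr => n _; rewrite /= feval_component.
exact: hs.
Defined.

Lemma feval_homogeneous (X : nudga k) (phi : term -> A -> int -> X) n
    (v : free_graded) : graded_assignment phi -> homogeneous n v -> homogeneous
      n (feval phi v).
Proof.
by move=> hphi vn; rewrite /homogeneous -feval_component // (vn :
  free_component n v = v).
Qed.

Lemma free_homogeneousP n (v : free_graded) :
  (forall (X : nudga k) (phi : term -> A -> int -> X), graded_assignment phi ->
    homogeneous n (feval phi v)) -> homogeneous n v.
Proof.
move=> vn; apply: free_ext => X phi hphi.
by rewrite feval_component //; apply: vn.
Qed.

Let zero_diff : {linear free_type -> free_type} := \0.

(** The free graded algebra with zero differential; the differential of the
    replacement is defined afterwards, by recursion over the cells. *)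
Definition free_nudga : nudga k.
Proof.
apply: (@NuDGA k free_graded free_mul zero_diff).
- move=> w c u v; apply: free_ext => X phi hphi.
  by rewrite !(fevalE, feval_linear) // mulDl mulZl.
- move=> w c u v; apply: free_ext => X phi hphi.
  by rewrite !(fevalE, feval_linear) // mulDr mulZr.
- by move=> u v w; apply: free_ext => X phi hphi; rewrite !fevalE // mul_assoc.
- move=> m n u v um vn; apply: free_homogeneousP => X phi hphi.
  by rewrite fevalE //; apply: mul_homogeneous; apply: feval_homogeneous.
- by move=> n v _; apply: hom0.
- by [].
move=> n u v _; apply: free_ext => X phi hphi /=.
by rewrite !fevalE // mul0x mulx0 scaler0 addr0.
Defined.

Lemma cls_TAdd s t : cls (TAdd s t) = cls s + cls t.
Proof. by apply: free_ext => X phi hphi; rewrite feval_cls // fevalE // !feval_cls. Qed.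
Lemma cls_TScale c t : cls (TScale c t) = c *: cls t.
Proof. by apply: free_ext => X phi hphi; rewrite feval_cls // fevalE // !feval_cls. Qed.
Lemma cls_TMul s t : cls (TMul s t) = free_mul (cls s) (cls t).
Proof. by apply: free_ext => X phi hphi; rewrite feval_cls // fevalE // !feval_cls. Qed.
Lemma cls_TComp n t : cls (TComp n t) = free_component n (cls t).
Proof. by apply: free_ext => X phi hphi; rewrite feval_cls // fevalE // !feval_cls. Qed.
Lemma cls_TGen z a n : homogeneous n (cls (TGen z a n) : free_graded).
Proof.
by apply: free_homogeneousP => X phi hphi; rewrite feval_cls //; apply: hphi.
Qed.

End Terms.

(** * The differential on the free algebra *)

Section DualNumbers.
Variables (k : comPzRingType) (V : nudga k).

Let dual_graded : graded_module k := gprod V (gshift V (-1)).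

(** Square-zero extension of V by its own shift, with sign-twisted left action:
    a homomorphism x |-> (x, D x) to it is the same as a derivation D of degree
    -1. *)
Definition dual_mul (u v : dual_graded) : dual_graded :=
  (mul u.1 v.1, mul u.2 v.1 + mul (gsign u.1) v.2).

Let zero_diff : {linear dual_graded -> dual_graded} := \0.

Definition dual_nudga : nudga k.
Proof.
apply: (@NuDGA k dual_graded dual_mul zero_diff).
- move=> w c u v; rewrite /dual_mul /= linearP /= !mulDl !mulZl.
  by congr (_, _) => /=; rewrite scalerDr addrACA.
- move=> w c u v; rewrite /dual_mul /= !mulDr !mulZr.
  by congr (_, _) => /=; rewrite scalerDr addrACA.
- move=> u v w; rewrite /dual_mul /= !mulDl !mulDr gsign_mul !mul_assoc.
  by rewrite addrA.
- move=> m n u v /gprod_hom[u1 u2] /gprod_hom[v1 v2]; apply/gprod_hom; split.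
    exact: mul_homogeneous.
  apply: homD; rewrite /homogeneous /=.
    by rewrite addrAC; apply: mul_homogeneous.
  by rewrite -addrA; apply: mul_homogeneous => //; apply: hom_gsign.
- by move=> n v _; apply: hom0.
- by [].
move=> n u v _; rewrite [LHS]/= -[dual_mul (zero_diff u) v]/(dual_mul (0, 0) v).
rewrite -[dual_mul u (zero_diff v)]/(dual_mul u (0, 0)) /dual_mul /=.
by rewrite !mul0x !mulx0 linear0 mul0x !addr0 -[(0, 0)]/(0 : dual_graded) scaler0 addr0.
Defined.

End DualNumbers.

Arguments free_nudga : simpl never.
Arguments free_graded : simpl never.

Section Replacement.
Variables (k : comPzRingType) (A : nudga k).

Let V := free_nudga A.
Let class (t : term A) : V := cls t.

(** With b the boundary and the image of z, this says that z is a cycle of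
    degree n - 1 whose image is the boundary of the component of a in degree
    n. *)
Definition fillable (b : V * A) (z : term A) (a : A) (n : int) : Prop :=
  [/\ b.1 = 0, homogeneous (n - 1) (class z) & diff (component n a) = b.2].

(** The boundary of t in the free algebra, and its image in A. They are computed
    together since the test for [TGen z a n] needs both values at z. *)
Fixpoint bd (t : term A) : V * A :=
  match t with
  | TZero => (0, 0)
  | TAdd s t => ((bd s).1 + (bd t).1, (bd s).2 + (bd t).2)
  | TScale c t => (c *: (bd t).1, c *: (bd t).2)
  | TMul s t => (mul (bd s).1 (class t) + mul (gsign (class s)) (bd t).1,
                 mul (bd s).2 (bd t).2)
  | TComp n t => (component (n - 1) (bd t).1, component n (bd t).2)
  | TGen z a n => if `[< fillable (bd z) z a n >] then (class z, component n a)
                  else (0, 0)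
  end.

Definition fills (z : term A) (a : A) (n : int) : bool := `[< fillable (bd z) z a n >].

Lemma bd_TGen z a n :
  bd (TGen z a n) = if fills z a n then (class z, component n a) else (0, 0).
Proof. by []. Qed.

Definition aug_gen (z : term A) (a : A) (n : int) : A :=
  if fills z a n then component n a else 0.

Lemma aug_gen_graded : graded_assignment aug_gen.
Proof.
by move=> z a n; rewrite /aug_gen; case: ifP => _; [apply: hom_component | apply: hom0].
Qed.

Lemma eval_aug t : eval aug_gen t = (bd t).2.
Proof.
elim: t => //= [s -> t ->|c t ->|s -> t ->|n t ->|z _ a n] //.
by rewrite -/(fills z a n) /aug_gen; case: ifP.
Qed.

Definition bd_gen (z : term A) (a : A) (n : int) : dual_nudga V :=
  (class (TGen z a n), (bd (TGen z a n)).1).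

Lemma bd_gen_graded : graded_assignment bd_gen.
Proof.
move=> z a n; apply/gprod_hom; split; first exact: cls_TGen.
suff : homogeneous (n - 1) (bd (TGen z a n)).1 by [].
by rewrite bd_TGen; case: ifP => [/asboolP[]|_] //; apply: hom0.
Qed.

Lemma eval_bd t : eval bd_gen t = (class t, (bd t).1).
Proof.
elim: t => [|s IHs t IHt|c t IHt|s IHs t IHt|n t IHt|z _ a n] //=.
- by rewrite IHs IHt /class cls_TAdd.
- by rewrite IHt /class cls_TScale.
- by rewrite IHs IHt /class cls_TMul.
- by rewrite IHt /class cls_TComp.
Qed.

Definition bdry (v : V) : V := (feval bd_gen v).2.

Lemma bdry_class t : bdry (class t) = (bd t).1.
Proof. by rewrite /bdry feval_cls ?eval_bd //; apply: bd_gen_graded. Qed.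

Fact bdry_linear : linear bdry.
Proof.
by move=> c v w; rewrite /bdry feval_linear //; apply: bd_gen_graded.
Qed.
HB.instance Definition _ := GRing.isLinear.Build k V V _ bdry bdry_linear.

Lemma classE (v : V) : v = class (rep v).
Proof. by rewrite /class repK. Qed.

Lemma class_mul s t : mul (class s) (class t) = class (TMul s t).
Proof. by rewrite /class cls_TMul. Qed.

Lemma class_component n t : component n (class t) = class (TComp n t).
Proof. by rewrite /class cls_TComp. Qed.

Lemma bdry_mul (v w : V) : bdry (mul v w) = mul (bdry v) w + mul (gsign v) (bdry w).
Proof.
rewrite [v]classE [w]classE class_mul !bdry_class /=.
by rewrite -!classE.
Qed.

Lemma bdry_component n (v : V) : bdry (component n v) = component (n - 1) (bdry v).
Proof. by rewrite [v]classE class_component !bdry_class. Qed.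

Lemma bdry_homogeneous n (v : V) : homogeneous n v -> homogeneous (n - 1) (bdry v).
Proof. by move=> vn; rewrite /homogeneous -bdry_component vn. Qed.

Lemma gsign_bdry (v : V) : gsign (bdry v) = - bdry (gsign v).
Proof.
rewrite (@gsign_homs _ _ _ bdry (-1)); last exact: bdry_homogeneous.
by rewrite degsignN degsign1 scaleN1r.
Qed.

(** The Leibniz rule reduces this to cells, where it is the requirement that
    only cycles are killed. *)
Lemma bdry_bdry (v : V) : bdry (bdry v) = 0.
Proof.
rewrite [v]classE bdry_class; elim: (rep v)
  => [|s IHs t IHt|c t IHt|s IHs t IHt|n t IHt|z _ a n] /=.
- by rewrite linear0.
- by rewrite linearD /= IHs IHt addr0.
- by rewrite linearZ /= IHt scaler0.
- rewrite linearD /= !bdry_mul IHs IHt mul0x mulx0 add0r addr0 -bdry_class.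
  by rewrite bdry_class -(bdry_class s) gsign_bdry mulNl -(bdry_class t) addNr.
- by rewrite bdry_component IHt linear0.
rewrite -/(fills z a n); case: ifP => [/asboolP[bz _ _]|_] /=; last by rewrite linear0.
by rewrite bdry_class.
Qed.

Definition replacement : nudga k.
Proof.
apply: (@NuDGA k V (@mul k V) bdry).
- exact: mul_linearl.
- exact: mul_linearr.
- exact: mul_assoc.
- exact: mul_homogeneous.
- exact: bdry_homogeneous.
- exact: bdry_bdry.
move=> n v w vn; apply: (etrans (bdry_mul v w)); rewrite -mulZl -(gsign_hom vn).
by [].
Defined.

Arguments replacement : simpl never.

Definition aug (v : V) : A := feval aug_gen v.

Fact aug_linear : linear aug.
Proof. by apply: feval_linear; apply: aug_gen_graded. Qed.
HB.instance Definition _ := GRing.isLinear.Build k V A _ aug aug_linear.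

Lemma aug_class t : aug (class t) = (bd t).2.
Proof. by rewrite /aug feval_cls ?eval_aug //; apply: aug_gen_graded. Qed.

Lemma aug_mul (v w : V) : aug (mul v w) = mul (aug v) (aug w).
Proof. by apply: feval_mul; apply: aug_gen_graded. Qed.

Lemma aug_homogeneous n (v : V) : homogeneous n v -> homogeneous n (aug v).
Proof. by apply: feval_homogeneous; apply: aug_gen_graded. Qed.

Lemma aug_component n (v : V) : aug (component n v) = component n (aug v).
Proof. by apply: feval_component; apply: aug_gen_graded. Qed.

Lemma aug_gsign (v : V) : aug (gsign v) = gsign (aug v).
Proof.
rewrite (@gsign_homs _ _ _ aug 0) ?scale1r // => n w.
by rewrite addr0; apply: aug_homogeneous.
Qed.

Lemma aug_bdry (v : V) : aug (bdry v) = diff (aug v).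
Proof.
rewrite [v]classE bdry_class aug_class.
elim: (rep v) => [|s IHs t IHt|c t IHt|s IHs t IHt|n t IHt|z _ a n] /=.
- by rewrite !linear0.
- by rewrite !linearD /= IHs IHt.
- by rewrite !linearZ /= IHt.
- by rewrite leibniz_gsign -IHs -IHt linearD /= !aug_mul aug_gsign !aug_class.
- by rewrite aug_component IHt diff_component.
rewrite -/(fills z a n); case: ifP => [/asboolP[_ _ /= ->]|_] /=; last by
  rewrite !linear0.
by rewrite aug_class.
Qed.

Definition augmentation : nudga_hom replacement A :=
  @NuDGAHom k replacement A aug aug_mul aug_homogeneous aug_bdry.

Definition cell (z : term A) (a : A) (n : int) : replacement := class (TGen z a n).

(** The defining property of cells, carried over from terms to classes. *)
Lemma replacement_cell n (z : replacement) (a : A) :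
  homogeneous (n - 1) z -> homogeneous n a -> diff z = 0 ->
  diff a = augmentation z ->
  exists x : replacement, diff x = z /\ augmentation x = a.
Proof.
move=> zn an dz da; exists (cell (rep z) a n).
have fill : fills (rep z) a n.
  apply/asboolP; split; last by rewrite an da /= -aug_class -classE.
    by rewrite -bdry_class -classE.
  by rewrite -classE.
split; first by apply: (etrans (bdry_class _)); rewrite bd_TGen fill -classE.
by apply: (etrans (aug_class _)); rewrite bd_TGen fill.
Qed.

(** For a homogeneous, the cell over the cycle d a gives a cycle z over d a, and
    the cell with boundary z gives a preimage of a. *)
Lemma augmentation_onto a : exists x : replacement, augmentation x = a.
Proof.
elim/graded_ind: a => [|a a' [x <-] [x' <-]|n a an].
- by exists 0; rewrite linear0.
- by exists (x + x'); rewrite linearD.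
have [|||| z [dz az]] := @replacement_cell (n - 1) 0 (diff a).
- exact: hom0.
- exact: diff_homogeneous.
- exact: linear0.
- by rewrite diff_diff linear0.
have [|||| x [_ <-]] := @replacement_cell n (component (n - 1) z) a => //.
- exact: hom_component.
- by rewrite diff_component dz linear0.
- by rewrite -component_hom_map az -diff_component an.
by exists x.
Qed.

(** Cells with boundary a cycle z whose image bounds give injectivity on
    homology, cells with boundary 0 surjectivity. *)
Lemma augmentation_qis : qis augmentation.
Proof.
apply: qis_homogeneous => [n z zn dz [a an da]|n a an da].
  have [|||| x [dx _]] := @replacement_cell (n + 1) z a => //.
    by rewrite addrK.
  by exists x.
have [|||| x [dx ax]] := @replacement_cell n 0 a => //.
- exact: hom0.
- exact: linear0.
- by rewrite da linear0.
by exists x, 0; rewrite linear0 addr0.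
Qed.

Section Lifting.
Variables (E F : nudga k) (q : nudga_hom E F) (g : nudga_hom replacement F).
Hypotheses (q_onto : forall y, exists x, q x = y) (q_qis : qis q).

(** One element serves whether or not e and y fit together: for homogeneous y
    it lies over y, and it has boundary e when that is possible. *)
Lemma pick_spec (e : E) (y : F) (n : int) :
  exists x : E, (homogeneous n y -> homogeneous n x /\ q x = y) /\
    (homogeneous n y -> homogeneous (n - 1) e -> diff e = 0 -> diff y = q e ->
     diff x = e).
Proof.
have [[yn en de dy]|no] := pselect [/\ homogeneous n y, homogeneous (n - 1) e,
    diff e = 0 & diff y = q e].
  by have [x [xn dx qx]] := onto_qis_lift q_onto q_qis en yn de dy; exists x.
have [x qx] := q_onto y; exists (component n x); split=> [yn|yn en de dy].
  by split; [apply: hom_component | rewrite -component_hom_map qx].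
by case: no.
Qed.

Definition pick_lift e y n : E := sval (cid (pick_spec e y n)).

Lemma pick_lift_hom e y n : homogeneous n y -> homogeneous n (pick_lift e y n).
Proof. by rewrite /pick_lift; case: cid => x [/= h _] /h[]. Qed.

Lemma pick_liftK e y n : homogeneous n y -> q (pick_lift e y n) = y.
Proof. by rewrite /pick_lift; case: cid => x [/= h _] /h[]. Qed.

Lemma diff_pick_lift e y n : homogeneous n y -> homogeneous (n - 1) e ->
  diff e = 0 -> diff y = q e -> diff (pick_lift e y n) = e.
Proof. by rewrite /pick_lift; case: cid => x []. Qed.

(** A cell is sent to a lift of its image in F whose boundary is the lift,
    already constructed, of its own boundary. *)
Fixpoint tlift (t : term A) : E :=
  match t with
  | TZero => 0
  | TAdd s t => tlift s + tlift t
  | TScale c t => c *: tlift t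
  | TMul s t => mul (tlift s) (tlift t)
  | TComp n t => component n (tlift t)
  | TGen z a n => pick_lift (if fills z a n then tlift z else 0) (g (cell z a n)) n
  end.

Definition lift_gen (z : term A) (a : A) (n : int) : E := tlift (TGen z a n).

Lemma g_cell_hom z a n : homogeneous n (g (cell z a n)).
Proof. by apply: hom_homogeneous; apply: cls_TGen. Qed.

Lemma lift_gen_graded : graded_assignment lift_gen.
Proof. by move=> z a n; apply: pick_lift_hom; apply: g_cell_hom. Qed.

Lemma eval_lift t : eval lift_gen t = tlift t.
Proof. by elim: t => //= [s -> t ->|c t ->|s -> t ->|n t ->]. Qed.

Definition lift_fun (v : V) : E := feval lift_gen v.

Fact lift_linear : linear lift_fun.
Proof. by apply: feval_linear; apply: lift_gen_graded. Qed.
HB.instance Definition _ := GRing.isLinear.Build k V E _ lift_fun lift_linear.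

Lemma lift_class t : lift_fun (class t) = tlift t.
Proof. by rewrite /lift_fun feval_cls ?eval_lift //; apply: lift_gen_graded. Qed.

Lemma lift_mul (v w : V) : lift_fun (mul v w) = mul (lift_fun v) (lift_fun w).
Proof. by apply: feval_mul; apply: lift_gen_graded. Qed.

Lemma lift_homogeneous n (v : V) : homogeneous n v -> homogeneous n (lift_fun v).
Proof. by apply: feval_homogeneous; apply: lift_gen_graded. Qed.

Lemma lift_component n (v : V) : lift_fun (component n v) = component n (lift_fun v).
Proof. by apply: feval_component; apply: lift_gen_graded. Qed.

Lemma lift_gsign (v : V) : lift_fun (gsign v) = gsign (lift_fun v).
Proof.
rewrite (@gsign_homs _ _ _ lift_fun 0) ?scale1r // => n w.
by rewrite addr0; apply: lift_homogeneous.
Qed.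

Lemma liftK (v : V) : q (lift_fun v) = g v.
Proof.
rewrite [v]classE lift_class.
elim: (rep v) => [|s IHs t IHt|c t IHt|s IHs t IHt|n t IHt|z _ a n] /=.
- by rewrite linear0 /class -[cls _]/(0 : replacement) linear0.
- by rewrite linearD /= IHs IHt -linearD /class cls_TAdd.
- by rewrite linearZ /= IHt -linearZ /class cls_TScale.
- by rewrite hom_mul IHs IHt -hom_mul /class cls_TMul.
- by rewrite -component_hom_map IHt component_hom_map /class cls_TComp.
by rewrite pick_liftK //; apply: g_cell_hom.
Qed.

Lemma lift_bdry (v : V) : lift_fun (bdry v) = diff (lift_fun v).
Proof.
rewrite [v]classE bdry_class lift_class.
elim: (rep v) => [|s IHs t IHt|c t IHt|s IHs t IHt|n t IHt|z IHz a n] /=.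
- by rewrite !linear0.
- by rewrite !linearD /= IHs IHt.
- by rewrite !linearZ /= IHt.
- by rewrite leibniz_gsign -IHs -IHt linearD /= !lift_mul lift_gsign !lift_class.
- by rewrite lift_component IHt diff_component.
have dcell : diff (cell z a n) = (bd (TGen z a n)).1 by apply: bdry_class.
rewrite -/(fills z a n) diff_pick_lift; first 1 last.
- exact: g_cell_hom.
- case: ifP => [/asboolP[_ zn _]|_]; last exact: hom0.
  by rewrite -lift_class; apply: lift_homogeneous.
- case: ifP => [/asboolP[dz _ _]|_]; last exact: linear0.
  by rewrite -IHz dz linear0.
- rewrite -hom_diff dcell bd_TGen; case: ifP => _; last by rewrite !linear0.
  by rewrite -lift_class liftK.
by case: ifP => _; rewrite ?lift_class ?linear0.
Qed.

Definition lift_hom : nudga_hom replacement E :=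
  @NuDGAHom k replacement E lift_fun lift_mul lift_homogeneous lift_bdry.

End Lifting.

Lemma replacement_cofibrant : cofibrant replacement.
Proof.
move=> E F q g q_onto /quasi_isoP q_qis.
by exists (lift_hom g q_onto q_qis) => v; apply: liftK.
Qed.

End Replacement.

(** * Module homomorphisms *)

Section Bounded.
Variable k : comPzRingType.

(** F has nonzero components in finitely many degrees only. The requirement
    makes the space of module homomorphisms the direct sum, and not the product,
    of its homogeneous parts. *)
Definition bounded (M N : graded_module k) (F : M -> N) : Prop :=
  exists s : seq int, forall m x, homogeneous m x ->
    forall n, n \notin s -> component (m + n) (F x) = 0.

Lemma bounded_degree (M N : graded_module k) (F : M -> N) a :
  (forall m x, homogeneous m x -> homogeneous (m + a) (F x)) -> bounded F.
Proof.
move=> Fh; exists [:: a] => m x xm n; rewrite inE => na.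
by rewrite (component_hom _ (Fh _ _ xm)) (inj_eq (addrI m)) (negbTE na).
Qed.

Lemma boundedP (M N : graded_module k) (F G : M -> N) c :
  bounded F -> bounded G -> bounded (fun x => c *: F x + G x).
Proof.
move=> [s Fs] [t Gt]; exists (s ++ t) => m x xm n.
rewrite mem_cat negb_or => /andP[ns nt].
by rewrite linearP /= (Fs _ _ xm) ?(Gt _ _ xm) // scaler0 addr0.
Qed.

Lemma bounded_comp (M N P : graded_module k) (F : {linear N -> P}) (G : M -> N) :
  bounded F -> bounded G -> bounded (fun x => F (G x)).
Proof.
move=> [s Fs] [t Gt]; exists [seq i + j | i <- t, j <- s] => m x xm n nst.
rewrite -[G x]sum_component !linear_sum big1 //= => l _.
have [lt|lt] := boolP (l - m \in t); last first.
  have -> : l = m + (l - m) by rewrite addrC subrK.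
  by rewrite (Gt _ _ xm) // !linear0.
have -> : m + n = l + (n - (l - m)) by rewrite opprB addrCA [l + _]addrC subrK addrC.
apply: Fs; first exact: hom_component.
apply: contra nst => ns; have -> : n = (l - m) + (n - (l - m)) by rewrite addrC subrK.
exact: allpairs_f.
Qed.

Lemma bounded_mul (A : nudga k) (a : A) : bounded (mul a).
Proof.
exists (gsupp a) => m x xm n na.
have := @component_homs _ _ _ (mul^~ x) m (@mul_linearl k A x) _ n a.
rewrite addrC => -> => [|i y yi]; last exact: mul_homogeneous.
by rewrite component_out // mul0x.
Qed.

End Bounded.

Lemma component_mul_homr (k : comPzRingType) (A : nudga k) (x y : A) m l :
  homogeneous l y -> component (m + l) (mul x y) = mul (component m x) y.
Proof.
move=> yl; apply: (@component_homs _ _ _ (mul^~ y) l (@mul_linearl k A y)).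
by move=> n z zn; apply: mul_homogeneous.
Qed.

Section GHom.
Variables (k : comPzRingType) (Q B : nudga k) (f : nudga_hom Q B).

Definition right_linear (F : Q -> B) : Prop :=
  forall x y, F (mul x y) = mul (F x) (f y).

Definition is_ghom (F : Q -> B) : Prop := [/\ linear F, right_linear F & bounded F].

Definition ghom_pred : {pred Q -> B} := [pred F | `[< is_ghom F >]].

Fact ghom_submod_closed : submod_closed ghom_pred.
Proof.
split=> [|c F G].
  apply/asboolP; split=> [a x y|x y|]; rewrite /= ?scaler0 ?addr0 ?mul0x //.
  by exists [::] => m x _ n _; rewrite linear0.
rewrite !inE => /asboolP[Fl Fr Fb] /asboolP[Gl Gr Gb]; apply/asboolP; split.
- move=> a x y; rewrite -[LHS]/(c *: F (a *: x + y) + G (a *: x + y)).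
  rewrite -[RHS]/(a *: (c *: F x + G x) + (c *: F y + G y)).
  by rewrite Fl Gl !scalerDr addrACA !scalerA [c * a]mulrC.
- move=> x y; rewrite -[LHS]/(c *: F (mul x y) + G (mul x y)).
  by rewrite Fr Gr -mulZl -mulDl.
- exact: boundedP.
Qed.
HB.instance Definition _ :=
  GRing.isSubmodClosed.Build k (Q -> B) ghom_pred ghom_submod_closed.

Record ghom_type := GHom { ghom_fun :> Q -> B; _ : ghom_fun \in ghom_pred }.

HB.instance Definition _ := [isSub for ghom_fun].
HB.instance Definition _ := [Choice of ghom_type by <:].
HB.instance Definition _ := [SubChoice_isSubLmodule of ghom_type by <:].

Definition mk_ghom (F : Q -> B) (Fp : is_ghom F) : ghom_type := GHom (asboolT Fp).

Lemma ghomP (F : ghom_type) : is_ghom F.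
Proof. by case: F => F /= /asboolP. Qed.

Fact ghom_linear (F : ghom_type) : linear F.
Proof. by have [] := ghomP F. Qed.
HB.instance Definition _ (F : ghom_type) :=
  GRing.isLinear.Build k Q B _ (ghom_fun F) (ghom_linear F).

Lemma ghom_mul (F : ghom_type) x y : F (mul x y) = mul (F x) (f y).
Proof. by have [] := ghomP F. Qed.

Lemma ghom_ext (F G : ghom_type) : (forall x, F x = G x) -> F = G.
Proof. by move=> FG; apply: val_inj; apply: funext. Qed.

Lemma ghomDE (F G : ghom_type) x : (F + G) x = F x + G x.
Proof. by []. Qed.
Lemma ghomZE c (F : ghom_type) x : (c *: F) x = c *: F x.
Proof. by []. Qed.
Lemma ghomNE (F : ghom_type) x : (- F) x = - F x.
Proof. by []. Qed.
Lemma ghom0E x : (0 : ghom_type) x = 0.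
Proof. by []. Qed.
Lemma ghom_hext (F G : ghom_type) :
  (forall m x, homogeneous m x -> F x = G x) -> F = G.
Proof.
move=> FG; apply: ghom_ext => x; elim/graded_ind: x => [|x y|m x xm].
- by rewrite !linear0.
- by rewrite !linearD /= => -> ->.
exact: FG xm.
Qed.

(** The part of F that raises degrees by n. *)
Definition ghom_component_fun n (F : Q -> B) : Q -> B :=
  gext (fun m y => component (m + n) (F y)).

Lemma ghom_component_funE n (F : ghom_type) m x :
  homogeneous m x -> ghom_component_fun n F x = component (m + n) (F x).
Proof.
by move=> xm; apply: gext_hom => // l c y z; rewrite !linearP.
Qed.

Fact ghom_component_is_ghom n (F : ghom_type) : is_ghom (ghom_component_fun n F).
Proof.
have Cl : linear (ghom_component_fun n F).
  by apply: gext_linear => m c x y; rewrite !linearP.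
pose C : {linear Q -> B} :=
  HB.pack (ghom_component_fun n F)
    (GRing.isLinear.Build _ _ _ _ (ghom_component_fun n F) Cl).
split=> //.
- move=> x y; rewrite -[ghom_component_fun n F]/(C : Q -> B).
  elim/graded_ind: x => [|x x'|m x xm].
  + by rewrite mul0x !linear0 mul0x.
  + by rewrite mulDl !linearD mulDl /= => -> ->.
  elim/graded_ind: y => [|y y'|l y yl].
  + by rewrite mulx0 !linear0 mulx0.
  + by rewrite mulDr !linearD mulDr /= => -> ->.
  rewrite /= (ghom_component_funE _ _ (mul_homogeneous xm yl))
    (ghom_component_funE _ _ xm).
  rewrite ghom_mul addrAC component_mul_homr //; exact: hom_homogeneous.
apply: (@bounded_degree _ _ _ _ n) => m x xm.
by rewrite (ghom_component_funE _ _ xm); apply: hom_component.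
Qed.

Definition ghom_component n (F : ghom_type) : ghom_type :=
  mk_ghom (ghom_component_is_ghom n F).

Arguments ghom_component : simpl never.

Lemma ghom_componentE n (F : ghom_type) m x :
  homogeneous m x -> ghom_component n F x = component (m + n) (F x).
Proof. exact: ghom_component_funE. Qed.

Fact ghom_component_linear n : linear (ghom_component n).
Proof.
move=> c F G; apply: ghom_hext => m x xm.
by rewrite ghomDE ghomZE !(ghom_componentE _ _ xm) linearP.
Qed.
HB.instance Definition _ n := GRing.isLinear.Build k ghom_type ghom_type _
  (ghom_component n) (ghom_component_linear n).

Lemma ghom_sumE (s : seq int) (G : int -> ghom_type) x :
  (\sum_(n <- s) G n) x = \sum_(n <- s) G n x.
Proof. by elim: s => [|n s IH]; rewrite ?big_nil // !big_cons -IH. Qed.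

Definition ghom : graded_module k.
Proof.
apply: (@GradedModule k ghom_type (fun n => ghom_component n : {linear _ -> _})).
  move=> m n F; apply: ghom_hext => l x xl; rewrite (ghom_componentE _ _ xl).
  rewrite (ghom_componentE _ _ xl) component_comp (inj_eq (addrI l)).
  by case: eqP => // ?; rewrite (ghom_componentE _ _ xl).
move=> F; have [_ _ [s Fs]] := ghomP F; exists (undup s); split;
  first exact: undup_uniq.
apply: ghom_hext => m x xm; rewrite ghom_sumE.
rewrite -[LHS](@sum_component_on _ _ [seq m + n | n <- undup s]).
- by rewrite big_map; apply: eq_bigr => n _; rewrite (ghom_componentE _ _ xm).
- by rewrite map_inj_uniq ?undup_uniq //; apply: addrI.
move=> n ns; have -> : n = m + (n - m) by rewrite addrC subrK.
apply: Fs => //; apply: contra ns => ns; apply/mapP; exists (n - m).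
  by rewrite mem_undup.
by rewrite addrC subrK.
Defined.

Lemma ghom_homogeneousP n (F : ghom) :
  homogeneous n F <-> forall m x, homogeneous m x -> homogeneous (m + n) (F x).
Proof.
split=> [Fn m x xm|Fn].
  by rewrite -Fn (ghom_componentE _ _ xm); apply: hom_component.
apply: ghom_hext => m x xm; rewrite (ghom_componentE _ _ xm).
exact: Fn.
Qed.

Lemma ghom_gsignE (F : ghom) x : (gsign F : ghom) x = gsign (F (gsign x)).
Proof.
elim/graded_ind: F => [|F G IHF IHG|n F Fn].
- by rewrite linear0 !ghom0E linear0.
- by rewrite linearD !ghomDE IHF IHG linearD.
rewrite (gsign_hom Fn) ghomZE.
rewrite (@gsign_homs _ _ _ (ghom_fun F) n) ?gsignK //.
by apply/ghom_homogeneousP.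
Qed.

(** On F of degree n this is d F - (-1)^n F d, as conjugation by the grading
    involution multiplies F by (-1)^n. *)
Definition ghom_diff_fun (F : ghom) (x : Q) : B :=
  diff (F x) - gsign (F (gsign (diff x))).

Fact ghom_diff_is_ghom F : is_ghom (ghom_diff_fun F).
Proof.
split.
- move=> c x y; rewrite /ghom_diff_fun !linearP /=.
  by rewrite scalerDr addrACA.
- move=> x y; rewrite /ghom_diff_fun !(leibniz_gsign, ghom_mul, linearD) /=.
  rewrite !gsign_mul gsignK !ghom_mul !gsign_mul mulBl -!gsign_hom_map gsignK.
  by rewrite addrACA gsignK hom_diff subrr addr0.
have [_ _ Fb] := ghomP F.
have eb (M : graded_module k) : bounded (@gsign k M).
  by apply: (@bounded_degree _ _ _ _ 0) => m x; rewrite addr0; apply: hom_gsign.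
have db (M : nudga k) : bounded (@diff k M).
  by apply: (@bounded_degree _ _ _ _ (-1)) => m x; apply: diff_homogeneous.
have := @boundedP _ _ _ (fun x => gsign (F (gsign (diff x))))
  (fun x => diff (F x)) (-1).
move=> h; have -> : ghom_diff_fun F =
    fun x => -1 *: gsign (F (gsign (diff x))) + diff (F x).
  by apply: funext => x; rewrite scaleN1r addrC.
apply: h; last exact: (@bounded_comp _ _ _ _ (@diff k B)).
apply: (@bounded_comp _ _ _ _ (@gsign k B)) => //.
apply: (@bounded_comp _ _ _ _ (ghom_fun F)) => //.
exact: (@bounded_comp _ _ _ _ (@gsign k Q)).
Qed.

Definition ghom_diff (F : ghom) : ghom := mk_ghom (ghom_diff_is_ghom F).

Fact ghom_diff_linear : linear ghom_diff.
Proof.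
move=> c F G; apply: ghom_ext => x.
rewrite ghomDE ghomZE /= /ghom_diff_fun !ghomDE !ghomZE !linearP /=.
by rewrite scalerDr addrACA.
Qed.
HB.instance Definition _ :=
  GRing.isLinear.Build k ghom ghom _ ghom_diff ghom_diff_linear.

Lemma ghom_diffE (F : ghom) x : ghom_diff F x = diff (F x) - gsign (F (gsign (diff x))).
Proof. by []. Qed.

Lemma ghom_diff_homE n (F : ghom) x : homogeneous n F ->
  ghom_diff F x = diff (F x) - degsign k n *: F (diff x).
Proof.
by move=> Fn; rewrite ghom_diffE -ghom_gsignE (gsign_hom Fn).
Qed.

Lemma ghom_diff_homogeneous n (F : ghom) :
  homogeneous n F -> homogeneous (n - 1) (ghom_diff F).
Proof.
move=> Fn; apply/ghom_homogeneousP => m x xm; rewrite (ghom_diff_homE _ Fn).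
move/ghom_homogeneousP: Fn => Fn; apply: homB.
  by rewrite addrA; apply/diff_homogeneous/Fn.
by apply: homZ; rewrite addrA addrAC; apply/Fn/diff_homogeneous.
Qed.

Lemma ghom_diff_diff (F : ghom) : ghom_diff (ghom_diff F) = 0.
Proof.
apply: ghom_ext => x; rewrite ghom_diffE !(ghom_diffE F).
have -> : diff (gsign (diff x)) = 0 by
  rewrite -[LHS]opprK -gsign_diff diff_diff linear0 oppr0.
rewrite !linear0 ?subr0 ?addr0 linearB /=
  diff_diff sub0r [gsign (diff (F _))]gsign_diff opprK.
by rewrite addNr.
Qed.

End GHom.

Arguments ghom_diff : simpl never.
Arguments ghom : simpl never.

Section GHomOps.
Variables (k : comPzRingType) (Q B : nudga k) (f : nudga_hom Q B).
Notation EndQ := (ghom (id_hom Q)).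
Notation HomQB := (ghom f).
Implicit Types (F : HomQB) (G H : EndQ) (b c : B).

Fact fhom_is_ghom : is_ghom f f.
Proof.
split=> [||]; [exact: linearP | exact: hom_mul |].
by apply: (@bounded_degree _ _ _ _ 0) => m x; rewrite addr0; apply: hom_homogeneous.
Qed.
Definition fhom : HomQB := mk_ghom fhom_is_ghom.

Fact gcomp_is_ghom F G : is_ghom f (fun x => F (G x)).
Proof.
have [_ _ Fb] := ghomP F; have [_ _ Gb] := ghomP G.
split=> [c x y|x y|]; rewrite ?linearP ?ghom_mul //=.
exact: bounded_comp.
Qed.
Definition gcomp F G : HomQB := mk_ghom (gcomp_is_ghom F G).

Fact ghom_lmul_is_ghom b F : is_ghom f (fun x => mul b (F x)).
Proof.
have [_ _ Fb] := ghomP F; split=> [c x y|x y|].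
- by rewrite linearP mulDr mulZr.
- by rewrite ghom_mul mul_assoc.
pose mb : {linear B -> B} := HB.pack (mul b)
  (GRing.isLinear.Build _ _ _ _ (mul b) (mul_linearr b)).
by apply: (@bounded_comp _ _ _ _ mb) => //; apply: bounded_mul.
Qed.
Definition glmul b F : HomQB := mk_ghom (ghom_lmul_is_ghom b F).

Lemma fhomE x : fhom x = f x. Proof. by []. Qed.
Lemma gcompE F G x : gcomp F G x = F (G x). Proof. by []. Qed.
Lemma glmulE b F x : glmul b F x = mul b (F x). Proof. by []. Qed.

Lemma fhom_hom : homogeneous 0 fhom.
Proof.
by apply/ghom_homogeneousP => m x; rewrite addr0; apply: hom_homogeneous.
Qed.

Lemma gcomp_hom m n F G :
  homogeneous m F -> homogeneous n G -> homogeneous (m + n) (gcomp F G).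
Proof.
move=> /ghom_homogeneousP Fm /ghom_homogeneousP Gn; apply/ghom_homogeneousP.
by move=> l x xl; rewrite [m + n]addrC addrA; apply/Fm/Gn.
Qed.

Lemma glmul_hom m n b F :
  homogeneous m b -> homogeneous n F -> homogeneous (m + n) (glmul b F).
Proof.
move=> bm /ghom_homogeneousP Fn; apply/ghom_homogeneousP => l x xl.
by rewrite addrCA; apply: mul_homogeneous => //; apply: Fn.
Qed.

Lemma gcomp_linearl G : linear (gcomp^~ G).
Proof. by move=> c F F'; apply: ghom_ext. Qed.

Lemma gcomp_linearr F : linear (gcomp F).
Proof. by move=> c G G'; apply: ghom_ext => x; apply: linearP. Qed.

Lemma glmul_linearl F : linear (glmul^~ F).
Proof.
by move=> c b b'; apply: ghom_ext => x; rewrite ghomDE ghomZE !glmulE mulDl mulZl.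
Qed.

Lemma glmul_linearr b : linear (glmul b).
Proof.
move=> c F F'; apply: ghom_ext => x.
by rewrite ghomDE ghomZE !glmulE ghomDE ghomZE mulDr mulZr.
Qed.

Lemma fhom_diff : ghom_diff fhom = 0.
Proof.
apply: ghom_ext => x; rewrite ghom_diffE fhomE gsign_hom_map gsignK hom_diff.
by rewrite subrr.
Qed.

Lemma gcomp_diff F G : ghom_diff (gcomp F G) =
  gcomp (ghom_diff F) G + gcomp (gsign F) (ghom_diff G).
Proof.
apply: ghom_ext => x; rewrite ghomDE !(ghom_diffE, gcompE) ghom_gsignE.
rewrite [gsign (_ - _)]linearB /= gsignK [F (_ - _)]linearB [gsign (_ - _)]linearB /=.
by rewrite addrA subrK.
Qed.

Lemma glmul_diff b F : ghom_diff (glmul b F) =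
  glmul (diff b) F + glmul (gsign b) (ghom_diff F).
Proof.
apply: ghom_ext => x; rewrite ghomDE !(ghom_diffE, glmulE) leibniz_gsign.
by rewrite gsign_mul mulBr addrA.
Qed.

End GHomOps.

Arguments gcomp {k Q B f}.
Arguments glmul {k Q B f}.

Lemma gcompA (k : comPzRingType) (Q B : nudga k) (f : nudga_hom Q B)
    (F : ghom f) (G H : ghom (id_hom Q)) :
  gcomp F (gcomp G H) = gcomp (gcomp F G) H.
Proof. exact: ghom_ext. Qed.

(** * Cofibrant algebras as modules over themselves *)

Arguments gshift : simpl never.

Lemma gshift_hom (k : comPzRingType) (M : graded_module k) a n (x : M) :
  homogeneous n (x : gshift M a) = homogeneous (n + a) x.
Proof. by []. Qed.

Lemma degsign_inj (k : comPzRingType) (M : lmodType k) n (x : M) :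
  degsign k n *: x = 0 -> x = 0.
Proof. by move=> h; rewrite -[x]scale1r -(degsign_sqr k n) -scalerA h scaler0. Qed.

(** Q with its right module structure behaves like a cofibrant module: the map
    (phi, h) of degree n from Q to the cone of the quasi-isomorphism g of
    modules is a cycle, and [module_lift] exhibits it as a boundary. *)
Section ModuleLifting.
Variables (k : comPzRingType) (Q B : nudga k) (f : nudga_hom Q B).
Notation EndQ := (ghom (id_hom Q)).
Notation HomQB := (ghom f).
Variables (g : HomQB) (n : int) (phi : EndQ) (h : HomQB).
Hypotheses (g0 : homogeneous 0 g) (dg : ghom_diff g = 0) (g_qis : qis g).
Hypotheses (phin : homogeneous n phi) (dphi : ghom_diff phi = 0).
Hypotheses (hn : homogeneous (n + 1) h) (dh : ghom_diff h = gcomp g phi).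

Local Notation s := (degsign k n).

Fact twisted_diff_g x : diff (g x) = g (diff x).
Proof.
have := ghom_diff_homE x g0; rewrite dg ghom0E degsign0 scale1r.
by move/esym/eqP; rewrite subr_eq0 => /eqP.
Qed.

Fact twisted_diff_phi x : diff (phi x) = s *: phi (diff x).
Proof.
have := ghom_diff_homE x phin; rewrite dphi ghom0E.
by move/esym/eqP; rewrite subr_eq0 => /eqP.
Qed.

Fact twisted_diff_h x : diff (h x) = g (phi x) - s *: h (diff x).
Proof.
have := ghom_diff_homE x hn; rewrite dh gcompE degsignD1 scaleNr opprK.
by move=> ->; rewrite addrK.
Qed.

(** The algebra Q + M, where M is a shift of the cone of g and is a square-zero
    ideal with zero left action. The differential of q has component
    (phi q, h q) in M up to signs. *)
Definition cone_graded : graded_module k :=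
  gprod Q (gprod (gshift Q (n + 1)) (gshift B (n + 1 + 1))).

Definition cone_mul (u v : cone_graded) : cone_graded :=
  (mul u.1 v.1, (mul (u.2.1 : Q) v.1 : gshift Q (n + 1),
                 mul (u.2.2 : B) (f v.1) : gshift B (n + 1 + 1))).

Definition cone_diff_fun (u : cone_graded) : cone_graded :=
  (diff u.1, (s *: (phi u.1 - diff (u.2.1 : Q)) : gshift Q (n + 1),
              s *: (diff (u.2.2 : B) - h u.1 + g (u.2.1 : Q)) : gshift B (n + 1 + 1))).

Fact cone_diff_linear : linear cone_diff_fun.
Proof.
move=> c [q [x y]] [q' [x' y']]; rewrite /cone_diff_fun /=.
congr (_, (_, _)) => /=; first exact: linearP.
  rewrite !linearP /= scalerA [c * s]mulrC -scalerA -scalerDr; congr (s *: _).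
  by rewrite scalerDr addrACA.
rewrite !linearP /= scalerA [c * s]mulrC -scalerA -scalerDr; congr (s *: _).
by rewrite !scalerDr [X in X + _ = _]addrACA [LHS]addrACA.
Qed.

HB.instance Definition _ :=
  GRing.isLinear.Build k cone_graded cone_graded _ cone_diff_fun cone_diff_linear.

Definition cone : nudga k.
Proof.
apply: (@NuDGA k cone_graded cone_mul cone_diff_fun).
- move=> w c u v; rewrite /cone_mul /=.
  by congr (_, (_, _)) => /=; rewrite mulDl mulZl.
- move=> w c u v; rewrite /cone_mul /=.
  by congr (_, (_, _)) => /=; rewrite ?linearP /= mulDr mulZr.
- by move=> u v w; rewrite /cone_mul /= hom_mul !mul_assoc.
- move=> m l u v /gprod_hom[u1 /gprod_hom[u2 u3]] /gprod_hom[v1 _].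
  rewrite !gshift_hom in u2 u3.
  apply/gprod_hom; split; first exact: mul_homogeneous.
  apply/gprod_hom; rewrite !gshift_hom /= ![m + l + _]addrAC.
  by split; apply: mul_homogeneous => //; apply: hom_homogeneous.
- move=> m u /gprod_hom[u1 /gprod_hom[u2 u3]]; rewrite !gshift_hom in u2 u3.
  apply/gprod_hom; split; first exact: diff_homogeneous.
  have phim := (ghom_homogeneousP _ _).1 phin m _ u1.
  have hm := (ghom_homogeneousP _ _).1 hn m _ u1.
  have gm := (ghom_homogeneousP _ _).1 g0 _ _ u2.
  have e1 : m - 1 + (n + 1) = m + n by rewrite addrACA addNr addr0.
  have e2 : m - 1 + (n + 1 + 1) = m + (n + 1) by rewrite addrACA addNr addr0.
  have e3 : m + (n + 1 + 1) - 1 = m + (n + 1) by rewrite [m + (_ + _)]addrA addrK.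
  apply/gprod_hom; rewrite !gshift_hom /= e1 e2; split.
    apply/homZ/homB => //; have := diff_homogeneous u2.
    by rewrite addrA addrK.
  apply/homZ/homD; last by rewrite addr0 in gm.
  by apply: homB => //; rewrite -e3; apply: diff_homogeneous.
- move=> [q [x y]]; rewrite /= /cone_diff_fun /=; congr (_, (_, _)).
  + exact: diff_diff.
  + rewrite [diff (_ *: _)]linearZ [diff (_ - _)]linearB /= diff_diff subr0.
    by rewrite twisted_diff_phi scalerA degsign_sqr scale1r subrr scaler0.
  + have -> : diff (s *: (diff (y : B) - h q + g (x : Q)) : B) =
        h (diff q) - s *: g (phi q - diff (x : Q)).
      rewrite [LHS]linearZ [diff (_ + _)]linearD [diff (_ - _)]linearB /=.
      rewrite diff_diff sub0r twisted_diff_h twisted_diff_g [g (_ - _)]linearB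
        opprB -addrA.
      by rewrite scalerDr scalerA degsign_sqr scale1r -scalerN opprB [- _ + _]addrC.
    by rewrite [g (s *: _)]linearZ /= [_ - h _]addrAC subrr sub0r addNr scaler0.
move=> m [q [x y]] [r [x' y']] /gprod_hom[/= q_m /gprod_hom[/= xm ym]].
rewrite !gshift_hom in xm ym; rewrite /cone_diff_fun /cone_mul /= -/(degsign k m).
congr (_, (_, _)) => /=.
- exact: leibniz.
- rewrite ghom_mul (leibniz r xm) -/(degsign k _) degsignD degsignD1 mulrN scaleNr.
  rewrite opprB addrCA -mulBl scalerDr scalerA.
  by rewrite mulrCA degsign_sqr mulr1 mulZl addrC.
rewrite !ghom_mul (leibniz (f r) ym) -/(degsign k _) degsignD !degsignD1 opprK hom_diff.
rewrite [_ - mul (h q) _]addrAC -mulBl addrAC -mulDl.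
by rewrite scalerDr scalerA mulrCA degsign_sqr mulr1 mulZl.
Defined.

Definition cone_proj_fun (u : cone) : Q := (u : cone_graded).1.

Fact cone_proj_linear : linear cone_proj_fun. Proof. by []. Qed.
HB.instance Definition _ :=
  GRing.isLinear.Build k cone Q _ cone_proj_fun cone_proj_linear.

Fact cone_proj_homogeneous m (u : cone) :
  homogeneous m u -> homogeneous m (cone_proj_fun u).
Proof. by case/gprod_hom. Qed.

Definition cone_proj : nudga_hom cone Q :=
  @NuDGAHom k cone Q cone_proj_fun (fun _ _ => erefl) cone_proj_homogeneous
    (fun _ => erefl).

(** The kernel is a shift of the cone of g, acyclic as g is a
    quasi-isomorphism. *)
Lemma cone_proj_qis : qis cone_proj.
Proof.
apply: qis_onto => [q|m]; first by exists (q, (0, 0)).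
move=> [q [x y]] _ /= [dq dx dy] q0; move: dq dx dy; rewrite {}q0.
rewrite !linear0 sub0r ?subr0 ?addr0 => _ dx dy.
have {}dx : diff (x : Q) = 0.
  by apply: oppr_inj; rewrite oppr0; apply: degsign_inj dx.
have {}dy : g x = diff (- (y : B)).
  apply/eqP; rewrite linearN /= eq_sym -subr_eq0 -opprD oppr_eq0.
  by rewrite (degsign_inj dy).
have [inj sur] := g_qis; have [x' dx'] := inj x dx (ex_intro _ _ (esym dy)).
have [|c [w [dc ec]]] := sur ((y : B) + g x').
  by rewrite linearD /= twisted_diff_g dx' dy linearN addrN.
(* x' bounds x; subtracting the cycle c makes the B-component a boundary too. *)
exists ((0, (- s *: (x' - c) , s *: w)) : cone_graded) => //=.
rewrite /cone_diff_fun /= !linear0; congr (_, (_, _)).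
  rewrite sub0r linearZ /= scaleNr opprK scalerA degsign_sqr scale1r.
  by rewrite linearB /= dx' dc subr0.
rewrite ?subr0 ?addr0 [g (_ *: _)]linearZ [diff (_ *: _)]linearZ /=
  scaleNr -scalerBr scalerA.
by rewrite degsign_sqr scale1r linearB /= opprB addrA [diff w + _]addrC -ec addrK.
Qed.

Hypothesis Qcof : cofibrant Q.

(** The components in M of a section of the projection are right linear because
    the left action on M is zero, and commuting with the twisted differential
    means that they bound (phi, h). *)
Lemma module_lift : exists (phi' : EndQ) (h' : HomQB),
  [/\ homogeneous (n + 1) phi', homogeneous (n + 1 + 1) h',
      ghom_diff phi' = phi & h = gcomp g phi' + ghom_diff h'].
Proof.
have [] := @Qcof cone Q cone_proj (id_hom Q).
- by move=> q; exists (q, (0, 0)).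
- exact/quasi_isoP/cone_proj_qis.
move=> l lK; have l1 x : (l x).1 = x := lK x.
have lhom m x : homogeneous m x ->
    homogeneous (m + (n + 1)) ((l x).2.1 : Q) /\
    homogeneous (m + (n + 1 + 1)) ((l x).2.2 : B).
  by move=> xm; have /gprod_hom[_ /gprod_hom] := hom_homogeneous l xm.
have phi_is : is_ghom (id_hom Q) (fun x => (l x).2.1 : Q).
  split=> [c x y|x y|]; first by rewrite linearP.
    by rewrite hom_mul /= /cone_mul /= l1.
  by apply: (@bounded_degree _ _ _ _ (n + 1)) => m x /lhom[].
have h_is : is_ghom f (fun x => (l x).2.2 : B).
  split=> [c x y|x y|]; first by rewrite linearP.
    by rewrite hom_mul /= /cone_mul /= l1.
  by apply: (@bounded_degree _ _ _ _ (n + 1 + 1)) => m x /lhom[].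
have phi'n : homogeneous (n + 1) (mk_ghom phi_is : EndQ).
  by apply/ghom_homogeneousP => m x /lhom[].
have h'n : homogeneous (n + 1 + 1) (mk_ghom h_is : HomQB).
  by apply/ghom_homogeneousP => m x /lhom[].
exists (mk_ghom phi_is), (mk_ghom h_is); split=> //.
  apply: ghom_ext => x; rewrite (ghom_diff_homE _ phi'n) /= hom_diff /= l1.
  rewrite degsignD1 scaleNr opprK scalerA degsign_sqr scale1r.
  by rewrite addrC subrK.
apply: ghom_ext => x; rewrite ghomDE (ghom_diff_homE _ h'n) gcompE /= hom_diff /= l1.
rewrite !degsignD1 opprK scalerA degsign_sqr scale1r opprD addrA addrACA.
by rewrite opprB [g _ + _]addrA subrKA addrAC subrr add0r.
Qed.

End ModuleLifting.

Section Evaluation.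
Variables (k : comPzRingType) (Q B : nudga k) (f : nudga_hom Q B).
Notation EndQ := (ghom (id_hom Q)).
Notation HomQB := (ghom f).
Hypotheses (Qcof : cofibrant Q) (f_qis : qis f).
Variable e : Q.
Hypothesis e_unit : homology_unit e.

Let e0 : homogeneous 0 e. Proof. by case: e_unit. Qed.
Let de : diff e = 0. Proof. by case: e_unit. Qed.

(** The image of a homology unit is one, as H(f) is an isomorphism of
    algebras. *)
Lemma unit_image (b : B) : diff b = 0 -> exists w, diff w = b - mul b (f e).
Proof.
move=> db; have [x [w [dx ->]]] := f_qis.2 _ db.
have [_ _ /(_ x dx)[_ [y dy]]] := e_unit; exists (w - f y - mul w (f e)).
have dfe : diff (f e) = 0 by rewrite -hom_diff de linear0.
rewrite !linearB /= -hom_diff dy diff_mul_cycler // linearB hom_mul mulDl.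
by rewrite opprB opprD ![_ + (_ - _)]addrA [diff w + f x]addrC.
Qed.

(** Left multiplication by e induces the identity on homology, so it has a
    homotopy inverse on the right by [module_lift] for the identity of Q. *)
Lemma unit_homotopy_inverse : exists eta sigma : EndQ,
  [/\ homogeneous 0 eta, homogeneous 1 sigma, ghom_diff eta = 0 &
      forall x, x = mul e (eta x) + ghom_diff sigma x].
Proof.
pose one := fhom (id_hom Q); pose theta := glmul e one.
have one0 : homogeneous 0 one := fhom_hom _.
have th0 : homogeneous 0 theta by have := glmul_hom e0 one0; rewrite addr0.
have dth : ghom_diff theta = 0.
  by rewrite glmul_diff fhom_diff de; apply: ghom_ext => x;
    rewrite ghomDE !glmulE mul0x mulx0 addr0.
have th_qis : qis theta.
  split=> [x dx [y dy]|y dy].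
    have [_ _ /(_ x dx)[[z dz] _]] := e_unit; exists (y - z).
    by rewrite linearB /= dy dz glmulE fhomE /= opprB addrC subrK.
  have [_ _ /(_ y dy)[[z dz] _]] := e_unit; exists y, (- z); split=> //.
  by rewrite linearN /= dz opprB addrC subrK.
(* The cycle (0, id) in the cone of theta, of degree -1. *)
have [||||eta [sigma [eta0 sigma1 deta esig]]] :=
  @module_lift _ _ _ (id_hom Q) theta (-1) 0 one th0 dth th_qis _ _ _ _ Qcof.
- exact: hom0.
- exact: linear0.
- exact: one0.
- by rewrite fhom_diff; apply: ghom_ext => x; rewrite gcompE ghom0E linear0.
exists eta, sigma; split=> // x.
exact: (congr1 (fun F : EndQ => F x) esig).
Qed.

(** Up to homotopy a module cycle is determined by its value at e: the
    difference psi = h - h(e) f has a bounding value at e, so that psi vanishes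
    up to homotopy on the image of left multiplication by e, which by
    [unit_homotopy_inverse] is everything up to homotopy. *)
Lemma module_cycle (n : int) (h : HomQB) : homogeneous n h -> ghom_diff h = 0 ->
  exists2 beta : HomQB, homogeneous (n + 1) beta & 
    h = glmul (h e) (fhom f) + ghom_diff beta.
Proof.
move=> hn dh; have [eta [sigma [eta0 sigma1 deta etaK]]] := unit_homotopy_inverse.
have he_hom : homogeneous n (h e).
  by have /ghom_homogeneousP/(_ _ _ e0) := hn; rewrite add0r.
have dhe : diff (h e) = 0.
  have := ghom_diff_homE e hn; rewrite dh ghom0E de linear0 scaler0 subr0.
  by move=> <-.
pose psi : HomQB := h - glmul (h e) (fhom f).
have psin : homogeneous n psi.
  by apply: homB => //; have := glmul_hom he_hom (fhom_hom f); rewrite addr0.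
have dpsi : ghom_diff psi = 0.
  rewrite linearB /= dh glmul_diff fhom_diff dhe; apply: ghom_ext => x.
  by rewrite sub0r ghomNE ghomDE !glmulE mul0x ghom0E mulx0 addr0 oppr0.
have [w0 dw0] := unit_image dhe; pose w := component (n + 1) w0.
have dw : diff w = psi e.
  rewrite -component_diff dw0; have <- : psi e = h e - mul (h e) (f e) by [].
  by have /ghom_homogeneousP/(_ _ _ e0) := psin; rewrite add0r.
(* psi = psi (e eta) + psi (D sigma), and psi (e eta) = (d w) f eta. *)
pose beta : HomQB := glmul w (gcomp (fhom f) eta) + degsign k n *: gcomp psi sigma.
exists beta.
  apply: homD; last by apply/homZ/gcomp_hom.
  have := glmul_hom (hom_component (n + 1) w0) (gcomp_hom (fhom_hom f) eta0).
  by rewrite !addr0.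
have dbeta : ghom_diff beta = psi.
  rewrite linearD linearZ /= glmul_diff !gcomp_diff fhom_diff deta dpsi dw.
  rewrite (gsign_hom psin); apply: ghom_ext => x.
  have -> : psi x = mul (psi e) (f (eta x)) + psi (ghom_diff sigma x).
    rewrite {1}(etaK x) -[mul (psi e) _](ghom_mul psi e (eta x)).
    exact: (linearD (ghom_fun psi)).
  rewrite !(ghomDE, ghomZE, glmulE, gcompE, ghom0E) linear0 addr0 mulx0 addr0 add0r.
  by rewrite scalerA degsign_sqr scale1r.
by rewrite dbeta /psi addrC subrK.
Qed.

(** Evaluate the homotopy at e, and use that b f(e) and b are homologous. *)
Lemma module_cycle_inj (n : int) (b : B) (h : HomQB) :
  diff b = 0 -> homogeneous n b -> homogeneous (n + 1) h ->
  glmul b (fhom f) = ghom_diff h -> exists2 b', homogeneous (n + 1) b' & diff b' = b.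
Proof.
move=> db bn hn bh; have [w dw] := unit_image db.
have := congr1 (fun F : HomQB => F e) bh.
rewrite (ghom_diff_homE _ hn) glmulE fhomE de linear0 scaler0 subr0 => dhe.
exists (component (n + 1) (w + h e)); first exact: hom_component.
by rewrite -component_diff linearD /= dw dhe subrK bn.
Qed.

End Evaluation.

(** * The endomorphism algebra of a cofibrant algebra *)

Section EndoAlgebra.
Variables (k : comPzRingType) (Q : nudga k).
Notation EndQ := (ghom (id_hom Q)).

Definition endo_nudga : nudga k.
Proof.
apply: (@NuDGA k EndQ gcomp (@ghom_diff k Q Q (id_hom Q))).
- exact: gcomp_linearl.
- exact: gcomp_linearr.
- exact: gcompA.
- exact: gcomp_hom.
- exact: ghom_diff_homogeneous.
- exact: ghom_diff_diff.
move=> n F G Fn; apply: (etrans (gcomp_diff F G)); rewrite (gsign_hom Fn).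
by congr (_ + _); apply: ghom_ext.
Defined.

Definition endo_dga : dga k.
Proof.
apply: (@DGA k endo_nudga (fhom (id_hom Q))).
- exact: fhom_hom.
- by move=> F; apply: ghom_ext.
- by move=> F; apply: ghom_ext.
Defined.

Definition left_mul_fun (x : Q) : endo_dga := glmul x (fhom (id_hom Q)).

Fact left_mul_linear : linear left_mul_fun.
Proof. exact: glmul_linearl. Qed.
HB.instance Definition _ :=
  GRing.isLinear.Build k Q endo_dga _ left_mul_fun left_mul_linear.

Definition left_mul : nudga_hom Q endo_dga.
Proof.
apply: (@NuDGAHom k Q endo_dga left_mul_fun).
- by move=> x y; apply: ghom_ext => z; rewrite /= mul_assoc.
- by move=> n x xn; have := glmul_hom xn (fhom_hom (id_hom Q)); rewrite addr0.
move=> x; rewrite /= -[diff (left_mul_fun x)]/(ghom_diff _) glmul_diff fhom_diff.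
by apply: ghom_ext => y; rewrite ghomDE !glmulE ghom0E mulx0 addr0.
Defined.

(** [module_cycle_inj] and [module_cycle] for the identity of Q are injectivity
    and surjectivity on homology. *)
Lemma left_mul_qis (e : Q) : cofibrant Q -> homology_unit e -> qis left_mul.
Proof.
have id_qis : qis (id_hom Q).
  split=> [x _ [y]|y dy]; first by exists y.
  by exists y, 0; rewrite linear0 addr0.
move=> Qcof eu; apply: qis_homogeneous => [n x xn dx [F Fn dF]|n F Fn dF].
  have [y _ dy] := module_cycle_inj id_qis eu dx xn Fn (esym dF).
  by exists y.
have [beta _ Fb] := module_cycle Qcof id_qis eu Fn dF.
exists (F e), beta; split=> //; have [e0 de _] := eu.
have := ghom_diff_homE e Fn; rewrite [ghom_diff F]dF ghom0E de linear0 scaler0 subr0.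
by move=> <-.
Qed.

End EndoAlgebra.

(** * Triangular matrices and uniqueness *)

Lemma glue_leibniz_cancel (V : zmodType) (p q r t y z w : V) :
  p - q - (r - t + (y + z)) = w - q - r - y + (t + (p - w - z)).
Proof.
rewrite !opprD opprK !addrA.
by rewrite [RHS](+%R.[ACl 1*7*6*2*3*5*4*8])%AC subrr add0r.
Qed.

Section Glue.
Variables (k : comPzRingType) (Q : nudga k) (B : dga k) (f : nudga_hom Q B).
Notation EndQ := (ghom (id_hom Q)).
Notation HomQB := (ghom f).

Let glue_graded : graded_module k := gprod B (gprod EndQ (gshift HomQB 1)).

(** Triangular matrices with diagonal (b, F) and off-diagonal entry h. The
    off-diagonal component of the differential compares b f with f F, so that a
    cycle is a pair of cycles b and F with a homotopy h between the
    corresponding maps from Q to B. *)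
Definition glue_mul (u v : glue_graded) : glue_graded :=
  (mul u.1 v.1, (gcomp u.2.1 v.2.1,
    gcomp u.2.2 v.2.1 + glmul (gsign u.1) v.2.2)).

Definition glue_diff_fun (u : glue_graded) : glue_graded :=
  (diff u.1, (ghom_diff u.2.1,
    glmul u.1 (fhom f) - gcomp (fhom f) u.2.1 - ghom_diff u.2.2)).

Fact glue_diff_linear : linear glue_diff_fun.
Proof.
move=> c [b [F h]] [b' [F' h']]; rewrite /glue_diff_fun /=.
rewrite glmul_linearl gcomp_linearr !linearP /=.
congr (_, (_, _)) => /=.
by rewrite !scalerDr [X in X + _ = _]addrACA [LHS]addrACA.
Qed.

HB.instance Definition _ :=
  GRing.isLinear.Build k glue_graded glue_graded _ glue_diff_fun glue_diff_linear.

Fact glue_mulA : associative glue_mul.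
Proof.
move=> u v w; rewrite /glue_mul /= mul_assoc !gcompA gsign_mul; congr (_, (_, _)).
apply: ghom_ext => x; rewrite !(ghomDE, gcompE, glmulE) mulDr !mul_assoc.
by rewrite addrA.
Qed.

Fact glue_diff_diff u : glue_diff_fun (glue_diff_fun u) = 0.
Proof.
rewrite /glue_diff_fun /= diff_diff ghom_diff_diff.
congr (_, (_, _)); rewrite !linearB /= ghom_diff_diff glmul_diff gcomp_diff !fhom_diff.
rewrite (gsign_hom (fhom_hom f)) scale1r; apply: ghom_ext => x.
rewrite !(ghomDE, ghomNE, glmulE, gcompE, ghom0E) mulx0 !(addr0, add0r, oppr0, opprK).
by rewrite addrACA addrN addNr addr0.
Qed.

Fact glue_leibniz m (u v : glue_graded) : homogeneous m u ->
  glue_diff_fun (glue_mul u v) =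
  glue_mul (glue_diff_fun u) v + degsign k m *: glue_mul u (glue_diff_fun v).
Proof.
move=> /gprod_hom[u1 /gprod_hom[u2 u3]].
rewrite gshift_hom in u3; rewrite /glue_diff_fun /glue_mul /=.
congr (_, (_, _)); first exact: leibniz.
  by rewrite gcomp_diff (gsign_hom u2); congr (_ + _); apply: ghom_ext.
rewrite linearD /= gcomp_diff glmul_diff gsignK.
rewrite (gsign_hom u1) (gsign_hom u3) gsign_diff degsignD1 (gsign_hom u1).
apply: ghom_ext => x; rewrite !(ghomDE, gcompE, glmulE, ghomNE, ghomZE) !fhomE.
have -> : diff (degsign k m *: u.1 : B) = degsign k m *: diff u.1 by rewrite linearZ.
move: (ghom_diff u.2.2 _) (ghom_diff v.2.2 x) => r z.
rewrite scaleNr scalerDr mulNl [mul (_ *: u.1) (_ - _)]mulZl scalerA degsign_sqr.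
rewrite scale1r !mulBr mul_assoc.
exact: glue_leibniz_cancel.
Qed.

Definition glue_nudga : nudga k.
Proof.
apply: (@NuDGA k glue_graded glue_mul glue_diff_fun).
- move=> w c u v; rewrite /glue_mul /= !gcomp_linearl linearP /= glmul_linearl.
  by rewrite mulDl mulZl; congr (_, (_, _)) => /=; rewrite scalerDr addrACA.
- move=> w c u v; rewrite /glue_mul /= !gcomp_linearr glmul_linearr.
  by rewrite mulDr mulZr; congr (_, (_, _)) => /=; rewrite scalerDr addrACA.
- exact: glue_mulA.
- move=> m n u v /gprod_hom[u1 /gprod_hom[u2 u3]] /gprod_hom[v1 /gprod_hom[v2 v3]].
  rewrite !gshift_hom in u3 v3; apply/gprod_hom; split; first exact: mul_homogeneous.
  apply/gprod_hom; split; first exact: gcomp_hom.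
  rewrite gshift_hom; apply: homD; first by rewrite addrAC; apply: gcomp_hom.
  by rewrite -addrA; apply: glmul_hom => //; apply: hom_gsign.
- move=> m u /gprod_hom[u1 /gprod_hom[u2 u3]]; rewrite !gshift_hom in u3.
  apply/gprod_hom; split; first exact: diff_homogeneous.
  apply/gprod_hom; split; first exact: ghom_diff_homogeneous.
  rewrite gshift_hom subrK; apply: homB.
    apply: homB; first by have := glmul_hom u1 (fhom_hom f); rewrite addr0.
    by have := gcomp_hom (fhom_hom f) u2; rewrite add0r.
  by have := ghom_diff_homogeneous u3; rewrite addrK.
- exact: glue_diff_diff.
exact: glue_leibniz.
Defined.

Definition glue : dga k.
Proof.
apply: (@DGA k glue_nudga ((one B, (fhom (id_hom Q), 0)) : glue_graded)).
- apply/gprod_hom; split; first exact: one_homogeneous.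
  by apply/gprod_hom; split; [apply: fhom_hom | apply: hom0].
- move=> [b [F h]]; rewrite /= /glue_mul /= mul_1x (gsign_hom (one_homogeneous B)).
  by congr (_, (_, _)); apply: ghom_ext => x;
    rewrite ?ghomDE ?glmulE ?scale1r ?mul_1x ?add0r.
move=> [b [F h]]; rewrite /= /glue_mul /= mul_x1.
by congr (_, (_, _)); apply: ghom_ext => x; rewrite ?ghomDE ?glmulE ?mulx0 ?addr0.
Defined.

Definition glue_fst_fun (u : glue) : B := (u : glue_graded).1.
Definition glue_snd_fun (u : glue) : endo_dga Q := (u : glue_graded).2.1.

Fact glue_fst_linear : linear glue_fst_fun. Proof. by []. Qed.
Fact glue_snd_linear : linear glue_snd_fun. Proof. by []. Qed.
HB.instance Definition _ :=
  GRing.isLinear.Build k glue B _ glue_fst_fun glue_fst_linear.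
HB.instance Definition _ :=
  GRing.isLinear.Build k glue (endo_dga Q) _ glue_snd_fun glue_snd_linear.

Fact glue_fst_homogeneous n (u : glue)
  : homogeneous n u -> homogeneous n (glue_fst_fun u).
Proof. by case/gprod_hom. Qed.
Fact glue_snd_homogeneous n (u : glue)
  : homogeneous n u -> homogeneous n (glue_snd_fun u).
Proof. by case/gprod_hom=> _ /gprod_hom[]. Qed.

Definition glue_fst : dga_hom glue B :=
  @DGAHom k glue B (@NuDGAHom k glue B glue_fst_fun (fun _ _ => erefl)
    glue_fst_homogeneous (fun _ => erefl)) erefl.
Definition glue_snd : dga_hom glue (endo_dga Q) :=
  @DGAHom k glue (endo_dga Q) (@NuDGAHom k glue (endo_dga Q)
    glue_snd_fun (fun _ _ => erefl)
    glue_snd_homogeneous (fun _ => erefl)) erefl.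

Hypotheses (Qcof : cofibrant Q) (f_qis : qis f).

(** The kernel is the cone of composition with f from End(Q) to Hom_Q(Q, B), up
    to shift; it is acyclic by [module_lift] for f itself. *)
Lemma glue_fst_qis : qis glue_fst.
Proof.
apply: qis_onto => [b|n]; first by exists ((b, (0, 0)) : glue_graded).
move=> [b [F h]] /gprod_hom[_ /gprod_hom[/= Fn hn]] du b0.
rewrite -[_ = 0]/(b = 0) in b0; rewrite gshift_hom in hn.
have dF : ghom_diff F = 0 := congr1 (fun u : glue_graded => u.2.1) du.
have {du} dh : glmul b (fhom f) - gcomp (fhom f) F - ghom_diff h = 0 :=
  congr1 (fun u : glue_graded => u.2.2) du.
rewrite {}b0 in dh *.
have {}dh : ghom_diff (- h) = gcomp (fhom f) F.
  rewrite linearN /=; apply/eqP; rewrite eq_sym -subr_eq0 opprK -oppr_eq0 opprD;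
    apply/eqP.
  apply: (etrans _ dh); apply: ghom_ext => x; rewrite !(ghomDE, ghomNE) glmulE mul0x.
  by rewrite sub0r.
have [F' [h' [_ _ dF' eh]]] := module_lift (fhom_hom f) (fhom_diff f)
  f_qis Fn dF (homN hn) dh Qcof.
exists ((0, (F', h')) : glue_graded) => //=.
rewrite /glue_diff_fun /= linear0 dF'; congr (_, (_, _)).
rewrite -[RHS]opprK eh opprD; congr (_ - _); apply: ghom_ext => x.
by rewrite !(ghomDE, ghomNE) glmulE mul0x sub0r.
Qed.

(** The kernel is the cone of b |-> b f from B to Hom_Q(Q, B), up to shift; it is
    acyclic by the two statements on module cycles. *)
Lemma glue_snd_qis (e : Q) : homology_unit e -> qis glue_snd.
Proof.
move=> eu; apply: qis_onto => [F|n]; first by exists ((0, (F, 0)) : glue_graded).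
move=> [b [F h]] /gprod_hom[/= bn /gprod_hom[/= _ hn]] du F0.
rewrite -[_ = 0]/(F = 0) in F0; rewrite gshift_hom in hn.
have db : diff b = 0 := congr1 (fun u : glue_graded => u.1) du.
have {du} dh : glmul b (fhom f) - gcomp (fhom f) F - ghom_diff h = 0 :=
  congr1 (fun u : glue_graded => u.2.2) du.
rewrite {}F0 in dh *.
have {}dh : glmul b (fhom f) = ghom_diff h.
  apply/eqP; rewrite -subr_eq0; apply/eqP; apply: (etrans _ dh).
  by apply: ghom_ext => x; rewrite !(ghomDE, ghomNE) gcompE linear0 oppr0 addr0.
have [b' b'n db'] := module_cycle_inj f_qis eu db bn hn dh.
pose h1 : HomQB := h - glmul b' (fhom f).
have h1n : homogeneous (n + 1) h1.
  by apply: homB => //; have := glmul_hom b'n (fhom_hom f); rewrite addr0.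
have dh1 : ghom_diff h1 = 0.
  rewrite linearB /= glmul_diff fhom_diff db' dh; apply: ghom_ext => x.
  by rewrite !(ghomDE, ghomNE) !glmulE ghom0E mulx0 addr0 subrr.
have dh1e : diff (h1 e) = 0.
  have := ghom_diff_homE e h1n; have [_ de _] := eu.
  by rewrite dh1 ghom0E de linear0 scaler0 subr0.
have [beta _ h1E] := module_cycle Qcof f_qis eu h1n dh1.
(* b' bounds b, and the cycle h1 e corrects the off-diagonal entry. *)
exists ((b' + h1 e, (0, - beta)) : glue_graded) => //=.
rewrite /glue_diff_fun /= linearD /= db' dh1e addr0 linear0; congr (_, (_, _)).
have hE x : h x = mul (h1 e) (f x) + ghom_diff beta x + mul b' (f x).
  by have := congr1 (fun F : HomQB => F x + mul b' (f x)) h1E; rewrite /= subrK.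
rewrite [ghom_diff (- _)]linearN opprK; apply: ghom_ext => x.
rewrite !(ghomDE, ghomNE) !glmulE gcompE linear0 oppr0 addr0 mulDl [RHS]hE.
apply: etrans (addrC _ _); rewrite -addrA; exact: erefl.
Qed.

End Glue.

Lemma dga_quasi_isomorphic_endo (k : comPzRingType) (Q : nudga k) (B : dga k)
    (f : nudga_hom Q B) (e : Q) :
  cofibrant Q -> homology_unit e -> qis f -> dga_quasi_isomorphic B (endo_dga Q).
Proof.
move=> Qcof eu f_qis; apply: (@rst_trans _ _ _ (glue f)).
  apply/rst_sym/rst_step; exists (glue_fst f).
  exact/quasi_isoP/glue_fst_qis.
apply: rst_step; exists (glue_snd f).
by apply/quasi_isoP; apply: glue_snd_qis eu.
Qed.

Theorem theorem8p1 (k : comPzRingType) (A : nudga k)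
    (hA : homotopy_unital A) :
  (* a cofibrant replacement of A exists, and each one is quasi-isomorphic to
     a unital dg algebra *)
  ((exists (Q : nudga k) (p : nudga_hom Q A), cofibrant Q /\ quasi_iso p) /\
   (forall (Q : nudga k) (p : nudga_hom Q A), cofibrant Q -> quasi_iso p ->
      exists (B : dga k) (f : nudga_hom Q B), quasi_iso f)) /\
  (* uniqueness, independently of the replacement of A *)
  (forall (Q Q' : nudga k) (p : nudga_hom Q A) (p' : nudga_hom Q' A)
      (B B' : dga k) (f : nudga_hom Q B) (f' : nudga_hom Q' B'),
      quasi_iso p -> quasi_iso p' -> quasi_iso f -> quasi_iso f' ->
      dga_quasi_isomorphic B B').
Proof.
have [u uu] := homotopy_unitalP hA.
have unit_of (Q : nudga k) (p : nudga_hom Q A) : qis p -> exists e : Q, homology_unit e.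
  by move=> p_qis; apply: homology_unit_lift p_qis uu.
have augP (X : nudga k) : quasi_iso (augmentation X).
  exact/quasi_isoP/augmentation_qis.
split; first split.
- exists (replacement A), (augmentation A); split=> //; exact: replacement_cofibrant.
- move=> Q p Qcof /quasi_isoP p_qis; have [e eu] := unit_of Q p p_qis.
  by exists (endo_dga Q), (left_mul Q); apply/quasi_isoP; apply: left_mul_qis eu.
move=> Q Q' p p' B B' f f'.
set R := replacement A; have Rcof : cofibrant R := @replacement_cofibrant k A.
have [r ru] := unit_of R (augmentation A) (augmentation_qis A).
suff to_R (X : nudga k) (q : nudga_hom X A) (C : dga k) (g : nudga_hom X C) :
    quasi_iso q -> quasi_iso g -> dga_quasi_isomorphic C (endo_dga R).
  move=> p_qis p'_qis f_qis f'_qis; apply: (@rst_trans _ _ _ (endo_dga R)).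
    exact: to_R p_qis f_qis.
  by apply: rst_sym; apply: to_R p'_qis f'_qis.
move=> /quasi_isoP q_qis /quasi_isoP g_qis.
set S := replacement X; have Scof : cofibrant S := @replacement_cofibrant k X.
have s_qis : qis (augmentation X) := augmentation_qis X.
have qs_qis := qis_comp q_qis s_qis.
have [l lK] := Scof R A (augmentation A) (comp_hom q (augmentation X))
  (@augmentation_onto k A) (augP A).
have l_qis : qis l := qis_cancel lK (augmentation_qis A) qs_qis.
have [e eu] := unit_of S _ qs_qis.
apply: (@rst_trans _ _ _ (endo_dga S)).
  exact: dga_quasi_isomorphic_endo Scof eu (qis_comp g_qis s_qis).
apply: rst_sym.
apply: (dga_quasi_isomorphic_endo Scof eu (f := comp_hom (left_mul R) l)).
exact: qis_comp (left_mul_qis Rcof ru) l_qis.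
Qed.
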